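(* Let $m$, $r$ and $d$ be integers such that $m \geq 2$, $d \geq 1$ is odd, and $2 \leq 2r \leq m-1$. Put $\beta = \lfloor rd/(m-2r) \rfloor$ and $t = rd \bmod (m-2r)$. Then there exists an $m\times m$ complex skew-symmetric matrix polynomial $W$ of degree exactly $d$ and rank exactly $2r$ with no elementary divisors at all (neither finite nor infinite), with $t$ left minimal indices equal to $\beta+1$ and $m-2r-t$ left minimal indices equal to $\beta$, and with the right minimal indices equal to the left minimal indices, such that the set of $m\times m$ complex skew-symmetric matrix polynomials of grade $d$ with rank at most $2r$ is a closed subset of $\mathrm{POL}^{ss}_{d,m\times m}$ equal to the closure $\overline{\mathrm{O}}(W)$ of the orbit $\mathrm{O}(W)$.
   Context: A matrix polynomial $P(\lambda)=\lambda^d A_d+\dots+\lambda A_1+A_0$ with complex matrix coefficients, where $A_d$ is allowed to be zero, is said to have grade $d$ (i.e. its degree is at most $d$). It is skew-symmetric if $A_i^T=-A_i$ for all $i$. $\mathrm{POL}^{ss}_{d,m\times m}$ denotes the vector space of all $m\times m$ complex skew-symmetric matrix polynomials of grade $d$, a metric space with distance $d(P,P')=\left(\sum_{i=0}^d\|A_i-A_i'\|_F^2\right)^{1/2}$ ($\|\cdot\|_F$ the Frobenius norm, $A_i'$ the coefficients of $P'$); closures and closed sets are with respect to this metric. The rank of a matrix polynomial is the largest size of a minor that is not the identically zero scalar polynomial (equivalently, its rank over the field $\mathbb{C}(\lambda)$). Finite eigenvalues and elementary divisors: if the non-zero diagonal entries (invariant polynomials) of the Smith form of $P$ under unimodular equivalence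 are $p_1(\lambda),p_2(\lambda),\dots$ (monic, each dividing the next), the finite eigenvalues are the roots of these polynomials, and the elementary divisors associated with a finite eigenvalue $\alpha$ are the factors $(\lambda-\alpha)^{\delta}$, $\delta>0$, being the exact powers of $(\lambda-\alpha)$ in the $p_j$ (with repetitions). The infinite elementary divisors of $P$, regarded as having grade $d$, are the elementary divisors associated with the eigenvalue $0$ of $\mathrm{rev}\,P(\lambda):=\lambda^d P(1/\lambda)$; $\infty$ is an eigenvalue of $P$ if $0$ is an eigenvalue of $\mathrm{rev}\,P$. Minimal indices: let $\mathcal{N}_{\rm left}(P)=\{y(\lambda)^T\in\mathbb{C}(\lambda)^{1\times m}: y(\lambda)^TP(\lambda)=0\}$ and $\mathcal{N}_{\rm right}(P)=\{x(\lambda)\in\mathbb{C}(\lambda)^{m\times 1}: P(\lambda)x(\lambda)=0\}$. A minimal basis of such a subspace is a basis consisting of vector polynomials whose sum of degrees is minimal among all bases consisting of vector polynomials; the ordered list of degrees of the vectors in a minimal basis does not depend on the minimal basis. The left (right) minimal indices of $P$ are the degrees of the vectors in a minimal basis of $\mathcal{N}_{\rm left}(P)$ (of $\mathcal{N}_{\rm right}(P)$). The complete eigenstructure of $P$ consists of all its finite and infinite eigenvalues, the corresponding elementary divisors, and its left and right minimal indices. For a skew-symmetric $P\in\mathrm{POL}^{ss}_{d,m\times m}$, the orbit $\mathrm{O}(P)$ is the set of all skew-symmetric matrix polynomials in $\mathrm{POL}^{ss}_{d,m\times m}$ with the same complete eigenstructure as $P$, and $\overline{\mathrm{O}}(P)$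 is its closure in $\mathrm{POL}^{ss}_{d,m\times m}$. *)

(* Defs.v *)
From HB Require Import structures.
From mathcomp Require Import all_boot all_order all_algebra.
From mathcomp Require Import all_classical all_reals all_analysis.
From mathcomp.real_closed Require Import complex.
From mathcomp Require Import ring lra.

Set Implicit Arguments.
Unset Strict Implicit.
Unset Printing Implicit Defensive.

Import Order.TTheory GRing.Theory Num.Theory.

Local Open Scope classical_set_scope.
Local Open Scope ring_scope.

(* The complex numbers are R[i] for R : realType.  A matrix polynomial is a   *)
(* matrix with polynomial entries.                                            *)

Section MatrixPolynomials.
Variable R : realType.
Local Notation C := R[i].
Local Notation K := {fraction {poly C}}.

Definition mpcoef m n (i : nat) (P : 'M[{poly C}]_(m, n)) : 'M[C]_(m, n) :=
  map_mx (coefp i) P.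

Definition has_grade m n (d : nat) (P : 'M[{poly C}]_(m, n)) : bool :=
  [forall i, forall j, size (P i j) <= d.+1]%N.

Definition ratmx m n (P : 'M[{poly C}]_(m, n)) : 'M[K]_(m, n) :=
  map_mx (@tofrac {poly C}) P.

Definition mprank m n (P : 'M[{poly C}]_(m, n)) : nat := \rank (ratmx P).

(* lambda^d P(1/lambda), for P of grade d *)
Definition mprev m n (d : nat) (P : 'M[{poly C}]_(m, n)) :
    'M[{poly C}]_(m, n) :=
  map_mx (fun p : {poly C} => \poly_(k < d.+1) p`_(d - k)) P.

(* s lists the nonzero diagonal entries of the Smith form of P, which is the  *)
(* diagonal matrix below: s`_i is 0 for i >= size s.                          *)
Definition invariant_polynomials m (P : 'M[{poly C}]_m) (s : seq {poly C}) :=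
  [/\ {in s, forall p, p \is monic}, (size s <= m)%N,
      sorted (@dvdp C) s &
      exists U V : 'M[{poly C}]_m,
        [/\ U \in unitmx, V \in unitmx &
            U *m P *m V = \matrix_(i, j) (s`_i *+ (i == j))]].

(* e lists, up to order, the exponents delta of the elementary divisors       *)
(* (lambda - alpha)^delta of P.  It is empty iff alpha is not an eigenvalue.  *)
Definition elementary_divisors m (P : 'M[{poly C}]_m) (alpha : C)
    (e : seq nat) :=
  exists2 s, invariant_polynomials P s &
    perm_eq e [seq delta <- [seq mup alpha p | p <- s] | (0 < delta)%N].

Definition infinite_elementary_divisors m (d : nat) (P : 'M[{poly C}]_m)
    (e : seq nat) :=
  elementary_divisors (mprev d P) 0 e.

Definition vdeg n (v : 'rV[{poly C}]_n) : nat := \max_(j < n) (size (v 0%R j)).-1.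

(* Subspaces of K^n are row spaces of matrices over K. *)
Definition polynomial_basis k l n (N : 'M[K]_(l, n))
    (B : 'M[{poly C}]_(k, n)) : bool :=
  row_free (ratmx B) && (ratmx B == N)%MS.

Definition minimal_basis k l n (N : 'M[K]_(l, n)) (B : 'M[{poly C}]_(k, n)) :=
  polynomial_basis N B /\
  forall B' : 'M[{poly C}]_(k, n), polynomial_basis N B' ->
    (\sum_(i < k) vdeg (row i B) <= \sum_(i < k) vdeg (row i B'))%N.

(* e lists, up to order, the degrees of the vectors of a minimal basis of N *)
Definition minimal_indices l n (N : 'M[K]_(l, n)) (e : seq nat) :=
  exists k (B : 'M[{poly C}]_(k, n)),
    minimal_basis N B /\ perm_eq e [seq vdeg (row i B) | i : 'I_k].

(* The row space of kermx A is the left null space of A.  The right null      *)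
(* space of P, with its vectors transposed, is the left null space of P^T.    *)
Definition left_minimal_indices m (P : 'M[{poly C}]_m) :=
  minimal_indices (kermx (ratmx P)).

Definition right_minimal_indices m (P : 'M[{poly C}]_m) :=
  minimal_indices (kermx (ratmx P)^T).

(* The eigenvalues need no separate clause: they are the points at which the  *)
(* list of elementary divisors is not empty.                                  *)
Definition same_complete_eigenstructure m (d : nat) (P Q : 'M[{poly C}]_m) :=
  [/\ forall alpha e,
        elementary_divisors P alpha e <-> elementary_divisors Q alpha e,
      forall e, infinite_elementary_divisors d P e <->
                infinite_elementary_divisors d Q e,
      forall e, left_minimal_indices P e <-> left_minimal_indices Q e &
      forall e, right_minimal_indices P e <-> right_minimal_indices Q e].

Definition frobenius m n (A : 'M[C]_(m, n)) : R :=
  Num.sqrt (\sum_i \sum_j Normc.normc (A i j) ^+ 2).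

Definition mpdist m n (d : nat) (P Q : 'M[{poly C}]_(m, n)) : R :=
  Num.sqrt (\sum_(i < d.+1) frobenius (mpcoef i P - mpcoef i Q) ^+ 2).

(* POL^ss_{d, m x m} *)
Record POLss (d m : nat) := POLssMk {
  POLss_val :> 'M[{poly C}]_m;
  _ : has_grade d POLss_val &&
      [forall i : 'I_d.+1, (mpcoef i POLss_val)^T == - mpcoef i POLss_val] }.

HB.instance Definition _ d m := [isSub for @POLss_val d m].
HB.instance Definition _ d m := [Choice of POLss d m by <:].

Lemma l2_triangle (I : finType) (f g h : I -> R) :
    (forall i, 0 <= f i <= g i + h i) ->
  Num.sqrt (\sum_i f i ^+ 2) <=
    Num.sqrt (\sum_i g i ^+ 2) + Num.sqrt (\sum_i h i ^+ 2).
Proof.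
move=> fgh; set G := Num.sqrt (\sum_i g i ^+ 2).
set H := Num.sqrt (\sum_i h i ^+ 2).
have sge0 (u : I -> R) : 0 <= \sum_i u i ^+ 2.
  by apply: sumr_ge0 => i _; exact: sqr_ge0.
have G0 : 0 <= G by exact: sqrtr_ge0.
have H0 : 0 <= H by exact: sqrtr_ge0.
have G2 : G ^+ 2 = \sum_i g i ^+ 2 by rewrite sqr_sqrtr.
have H2 : H ^+ 2 = \sum_i h i ^+ 2 by rewrite sqr_sqrtr.
have nul (u : I -> R) : \sum_i u i ^+ 2 = 0 -> forall i, u i = 0.
  move=> /eqP; rewrite psumr_eq0 => [|i _]; last exact: sqr_ge0.
  move=> /allP u0 i; apply/eqP; rewrite -sqrf_eq0.
  by apply: u0; rewrite mem_index_enum.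
have CS : \sum_i g i * h i <= G * H.
  have [GE|GN] := eqVneq G 0.
    rewrite big1 ?mulr_ge0// => i _.
    by rewrite (nul g) ?mul0r// -G2 GE expr0n.
  have [HE|HN] := eqVneq H 0.
    rewrite big1 ?mulr_ge0// => i _.
    by rewrite (nul h) ?mulr0// -H2 HE expr0n.
  have Gp : 0 < G by rewrite lt_neqAle eq_sym GN.
  have Hp : 0 < H by rewrite lt_neqAle eq_sym HN.
  have : \sum_i (G * H) *+ 2 * (g i * h i) <=
         \sum_i (H ^+ 2 * g i ^+ 2 + G ^+ 2 * h i ^+ 2).
    apply: ler_sum => i _; rewrite -subr_ge0.
    rewrite (_ : _ - _ = (H * g i - G * h i) ^+ 2) ?sqr_ge0//.
    by rewrite mulr2n; ring.
  rewrite big_split/= -!mulr_sumr -G2 -H2.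
  rewrite (_ : _ + _ = (G * H) *+ 2 * (G * H)); last by rewrite mulr2n; ring.
  by rewrite ler_pM2l// pmulrn_lgt0// mulr_gt0.
rewrite -(@ler_pXn2r _ 2)// ?nnegrE ?addr_ge0 ?sqrtr_ge0//.
rewrite sqr_sqrtr// sqrrD G2 H2.
apply: (@le_trans _ _ (\sum_i (g i + h i) ^+ 2)).
  apply: ler_sum => i _; have /andP[f0 fle] := fgh i.
  by rewrite ler_pXn2r// nnegrE (le_trans f0).
under eq_bigr => i _ do rewrite sqrrD.
rewrite 2!big_split/= lerD2r lerD2l sumrMnl.
by rewrite lerMn2r CS orbT.
Qed.

Lemma frobenius_ge0 m n (A : 'M[C]_(m, n)) : 0 <= frobenius A.
Proof. exact: sqrtr_ge0. Qed.

Lemma frobenius0 m n : frobenius (0 : 'M[C]_(m, n)) = 0.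
Proof.
rewrite /frobenius big1 ?sqrtr0// => i _; rewrite big1// => j _.
by rewrite mxE Normc.normc0 expr0n.
Qed.

Lemma frobenius_eq0 m n (A : 'M[C]_(m, n)) : frobenius A = 0 -> A = 0.
Proof.
move=> /eqP; rewrite sqrtr_eq0 => A0; apply/matrixP => i j; rewrite mxE.
have ge0 k : 0 <= \sum_l Normc.normc (A k l) ^+ 2.
  by apply: sumr_ge0 => l _; exact: sqr_ge0.
have : \sum_k \sum_l Normc.normc (A k l) ^+ 2 == 0.
  by rewrite eq_le A0 sumr_ge0.
rewrite psumr_eq0// => /allP/(_ i); rewrite mem_index_enum => /(_ isT).
rewrite psumr_eq0 => [|l _]; last exact: sqr_ge0.
move=> /allP/(_ j); rewrite mem_index_enum => /(_ isT).
by rewrite sqrf_eq0 => /eqP/Normc.eq0_normc.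
Qed.

Lemma normc_ge0 (z : C) : 0 <= Normc.normc z.
Proof. by case: z => a b; exact: sqrtr_ge0. Qed.

Lemma frobeniusN m n (A : 'M[C]_(m, n)) : frobenius (- A) = frobenius A.
Proof.
congr Num.sqrt; apply: eq_bigr => i _; apply: eq_bigr => j _.
by rewrite mxE normcN.
Qed.

Lemma frobeniusD m n (A B : 'M[C]_(m, n)) :
  frobenius (A + B) <= frobenius A + frobenius B.
Proof.
rewrite /frobenius !pair_bigA; apply: l2_triangle => -[i j] /=.
by rewrite mxE normc_ge0 le_normcD.
Qed.

Section Distance.
Variables d m : nat.
Implicit Types P Q S : POLss d m.

Lemma POLss_eqP P Q :
  (forall i, (i <= d)%N -> mpcoef i P = mpcoef i Q) -> P = Q.
Proof.
move=> PQ; apply: val_inj; apply/matrixP => i j /=; apply/polyP => k.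
have [kd|dk] := leqP k d.
  by move/matrixP: (PQ k kd) => /(_ i j); rewrite !mxE.
have coef0 S : (S i j)`_k = 0.
  by case: S => S /= /andP[/'forall_forallP/(_ i j) h _]; exact/nth_default/(leq_trans h).
by rewrite !coef0.
Qed.

Lemma mpdistxx P : mpdist d P P = 0.
Proof.
by rewrite /mpdist big1 ?sqrtr0// => i _; rewrite subrr frobenius0 expr0n.
Qed.

Lemma mpdist_positivity P Q : mpdist d P Q = 0 -> P = Q.
Proof.
move=> /eqP; rewrite sqrtr_eq0 => PQ0; apply: POLss_eqP => i id.
have : \sum_(k < d.+1) frobenius (mpcoef k P - mpcoef k Q) ^+ 2 == 0.
  by rewrite eq_le PQ0 sumr_ge0// => k _; exact: sqr_ge0.
rewrite psumr_eq0 => [|k _]; last exact: sqr_ge0.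
move=> /allP/(_ (Ordinal (id : i < d.+1)%N)); rewrite mem_index_enum.
by rewrite sqrf_eq0 => /(_ isT)/eqP/frobenius_eq0/eqP; rewrite subr_eq0 => /eqP.
Qed.

Lemma mpdist_sym P Q : mpdist d P Q = mpdist d Q P.
Proof.
congr Num.sqrt; apply: eq_bigr => i _.
by rewrite -opprB frobeniusN.
Qed.

Lemma mpdist_triangle Q P S : mpdist d P S <= mpdist d P Q + mpdist d Q S.
Proof.
apply: l2_triangle => i; rewrite frobenius_ge0/=.
apply: le_trans (frobeniusD _ _).
by rewrite addrA subrK.
Qed.

HB.instance Definition _ := isMetric.Build R (POLss d m)
  mpdistxx mpdist_positivity mpdist_sym mpdist_triangle.

End Distance.

Definition POLss_orbit d m (P : POLss d m) : set (POLss d m) :=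
  [set Q : POLss d m | same_complete_eigenstructure d P Q].

End MatrixPolynomials.

(* Main.v *)
Require Import Defs.
From HB Require Import structures.
From mathcomp Require Import all_boot all_order all_algebra.
From mathcomp Require Import perm.
From mathcomp Require Import all_classical all_reals all_analysis.
From mathcomp.real_closed Require Import complex.
From mathcomp Require Import zify ring.

Set Implicit Arguments.
Unset Strict Implicit.
Unset Printing Implicit Defensive.

Import Order.TTheory GRing.Theory Num.Theory.

Local Open Scope classical_set_scope.
Local Open Scope ring_scope.

(* Write u ^ v for the skew-symmetric matrix u^T v - v^T u.  Every
   skew-symmetric P of rank at most 2r is a sum of r products u_i ^ v_i, by
   skew-symmetric elimination over the principal ideal domain C[X].  If some
   deg u_i + deg v_i exceeds the grade d, then cancellation among the leading
   coefficients allows a symplectic change of the u_i and v_i that lowers the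
   degrees, so one may assume deg u_i + deg v_i <= d.  A product with
   deg u < (d - 1) / 2 is a limit of products with deg u one larger and deg v
   one smaller; hence P is a limit of sums with deg u_i <= k and
   deg v_i <= k + 1, where d = 2k + 1.

   These sums are parametrized by a vector space, in which the pairs (U, V)
   such that y |-> (y U^T, y V^T) is injective on the vector polynomials of
   degree < beta and surjective on those of degree <= beta form a Zariski
   open set, which an explicit zigzag matrix shows to be nonempty.  Every
   point is therefore a limit of such pairs along a line.  Surjectivity makes
   (U, V) right invertible at every finite point and at infinity, so that
   there are no elementary divisors; together with injectivity it determines
   the dimensions of the spaces of null vectors of degree <= beta and
   <= beta + 1, and hence the minimal indices. *)

(** * Unimodular completion *)

(** Euclidean algorithm by minimality: among all unimodular [V] whose product with [p] has a nonzero
    first entry, take one where that entry has least size. After division with remainder, a nonzero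
    remainder could be swapped into first position and would be smaller. *)
Lemma row_gcd (F : fieldType) n (p : 'rV[{poly F}]_(1 + n)) :
  exists V g, V \in unitmx /\ p *m V = row_mx (g%:M : 'M[_]_1) 0.
Proof.
have [->|p0] := eqVneq p 0.
  by exists 1%:M, 0; rewrite unitmx1 mul0mx raddf0 row_mx0.
pose good l := exists V : 'M[_]_(1 + n),
  [/\ V \in unitmx, (p *m V) 0 0 != 0 & size ((p *m V) 0 0) = l].
have col_swap (V : 'M[_]_(1 + n)) j : V \in unitmx -> (p *m V) 0 j != 0 ->
    good (size ((p *m V) 0 j)).
  move=> Vu Vj; exists (V *m tperm_mx 0 j).
  have -> : (p *m (V *m tperm_mx 0 j)) 0 0 = (p *m V) 0 j.
    by rewrite mulmxA -xcolE mxE tpermL.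
  by split=> //; rewrite unitmx_mul Vu unitmx_perm.
have [l /asboolP gl lmin] : exists2 l, `[< good l >] &
    forall l', `[< good l' >] -> (l <= l')%N.
  have [j pj] : exists j, p 0 j != 0.
    apply/existsP; apply: contraNT p0 => /existsPn pj.
    by apply/eqP/rowP => j; rewrite mxE; apply/eqP; rewrite -[_ == _]negbK pj.
  have exl : exists l, `[< good l >].
    exists (size (p 0 j)); apply/asboolP.
    by have := @col_swap 1%:M j; rewrite mulmx1 unitmx1; exact.
  by case: (ex_minnP exl) => l gl lmin; exists l.
have [V [Vu Vn0 Vl]] := gl.
pose q := p *m V; pose a := q 0 0.
pose E : 'M[{poly F}]_(1 + n) :=
  block_mx 1%:M (- \row_j (q 0 (rshift 1 j) %/ a)) 0 1%:M.
have Eu : E \in unitmx by rewrite unitmxE det_ublock !det1 mulr1 unitr1.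
have qE : q *m E = row_mx a%:M (\row_j (q 0 (rshift 1 j) %% a)).
  have q00 : lsubmx q = a%:M.
    apply/matrixP => i j; rewrite !ord1 [LHS]mxE [RHS]mxE eqxx mulr1n /a.
    by congr (q _ _); apply: val_inj.
  rewrite -[q in LHS]hsubmxK mul_row_block !mulmx1 mulmx0 addr0.
  congr row_mx => //.
  rewrite q00 mul_scalar_mx; apply/rowP => j.
  rewrite [LHS]mxE [X in X + _]mxE [X in _ * X]mxE [X in - X]mxE mulrN.
  rewrite [X in _ + X]mxE [RHS]mxE addrC.
  by rewrite {1}(divp_eq (q 0 (rshift 1 j)) a) mulrC addrAC subrr add0r.
exists (V *m E), a; split; first by rewrite unitmx_mul Vu.
rewrite mulmxA -/q qE; congr row_mx; apply/rowP => j; rewrite [LHS]mxE [RHS]mxE.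
apply/eqP; apply: contraT => r0.
have := ltn_modp (q 0 (rshift 1 j)) a; rewrite Vn0 ltnNge.
suff -> : (size a <= size (q 0 (rshift 1 j) %% a)%R)%N by [].
have Er : (p *m (V *m E)) 0 (rshift 1 j) = q 0 (rshift 1 j) %% a.
  by rewrite mulmxA -/q qE row_mxEr mxE.
rewrite /a Vl; apply: lmin; apply/asboolP; rewrite -Er.
by apply: col_swap; rewrite ?unitmx_mul ?Vu // Er.
Qed.

Lemma pid_mxS (A : pzSemiRingType) q m :
  pid_mx q.+1 = block_mx (1%:M : 'M[_]_1) 0 0 (pid_mx q)
    :> 'M[A]_(1 + q, 1 + m).
Proof.
apply/matrixP => i j; rewrite !mxE.
by do ![case: split_ordP => ? -> /[!mxE]]; rewrite ?ord1.
Qed.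

(** Induction on the rows: [row_gcd] turns the first row into (g, 0), the right inverse forces g to
    be a unit, and the lower right block inherits a right inverse. *)
Lemma right_invertible_pid (F : fieldType) q m (M : 'M[{poly F}]_(q, m)) Y :
    M *m Y = 1%:M ->
  (q <= m)%N /\ exists2 V, V \in unitmx & M *m V = pid_mx q.
Proof.
elim: q m M Y => [|q IH] m M Y MY.
  split=> //; exists 1%:M; first exact: unitmx1.
  by apply/matrixP => -[].
case: m M Y MY => [|m] M Y MY.
  move/matrixP: MY => /(_ ord0 ord0)/eqP; rewrite !mxE big_ord0.
  by rewrite eq_sym oner_eq0.
have [V1 [g [V1u V1g]]] := @row_gcd F m (usubmx (M : 'M[_]_(1 + q, 1 + m))).
pose N : 'M[_]_(1 + q, 1 + m) := M *m V1.
pose x := dlsubmx N; pose M' := drsubmx N.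
have MV : N = block_mx g%:M 0 x M'.
  have uN : usubmx N = row_mx g%:M 0 by rewrite -V1g mul_usub_mx.
  by rewrite -[LHS]submxK /ulsubmx /ursubmx uN row_mxKl row_mxKr.
pose Y' : 'M[_]_(1 + m, 1 + q) := invmx V1 *m Y.
have : N *m Y' = 1%:M.
  by rewrite /Y' /N mulmxA mulmxK.
rewrite MV -[Y']submxK mulmx_block !mul0mx !addr0 !mul_scalar_mx.
rewrite -[1%:M]submxK => /eq_block_mx[].
set a := ulsubmx Y'; set b := ursubmx Y'; set c := dlsubmx Y'.
set e := drsubmx Y'.
rewrite !scalar_mx_block !block_mxKul !block_mxKur !block_mxKdl !block_mxKdr.
move=> ga gb _ Me.
have gu : g * a 0 0 = 1 by move/matrixP: ga => /(_ 0 0); rewrite !mxE.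
have b0 : b = 0.
  (* Since g is a unit, g b = 0 gives b = 0; hence [e] alone is a right inverse of [M']. *)
  by rewrite -[b]scale1r -gu mulrC -scalerA gb scaler0.
rewrite b0 mulmx0 add0r in Me.
have [qm [V2 V2u V2M]] := IH _ _ _ Me.
split=> //.
pose h := a 0 0.
(* Chosen so that the columns of [pid_mx q] cancel the column [h *: x] left below the pivot. *)
pose z : 'M[_]_(m, 1) := - h *: (pid_mx q *m x).
have B1u : (block_mx 1%:M 0 0 V2 : 'M[_]_(1 + m)) \in unitmx.
  by rewrite unitmxE det_ublock det1 mul1r -unitmxE.
have B2u : (block_mx h%:M 0 z 1%:M : 'M[_]_(1 + m)) \in unitmx.
  rewrite unitmxE det_lblock det1 mulr1 det_scalar expr1.
  by apply/unitrP; exists g; rewrite [h * g]mulrC gu.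
exists (V1 *m (block_mx 1%:M 0 0 V2 *m block_mx h%:M 0 z 1%:M)).
  by rewrite !unitmx_mul V1u /=; apply/andP.
have -> (X : 'M[_]_(1 + m)) : M *m (V1 *m X) = N *m X by rewrite mulmxA.
rewrite MV mulmxA.
rewrite !mulmx_block !mul0mx !mulmx0 !mulmx1 !addr0 !add0r V2M.
rewrite mul_scalar_mx scale_scalar_mx gu mul_mx_scalar.
rewrite [RHS](pid_mxS _ q m).
rewrite mul0mx addr0; suff -> : h *: x + pid_mx q *m z = 0 by [].
rewrite /z -scalemxAr mulmxA mul_pid_mx minnn (minn_idPr qm).
by rewrite pid_mx_1 mul1mx scaleNr subrr.
Qed.

(** * Wedge products and skew-symmetric matrices *)

Definition wedge (A : comNzRingType) q m (U V : 'M[A]_(q, m)) : 'M[A]_m :=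
  U^T *m V - V^T *m U.

Section Wedge.
Variable A : comNzRingType.

Lemma tr_wedge q m (U V : 'M[A]_(q, m)) : (wedge U V)^T = - wedge U V.
Proof. by rewrite /wedge linearB /= !trmx_mul !trmxK opprB. Qed.

Lemma wedge_mulr q m l (U V : 'M[A]_(q, m)) (W : 'M[_]_(m, l)) :
  wedge (U *m W) (V *m W) = W^T *m wedge U V *m W.
Proof. by rewrite /wedge mulmxBr mulmxBl !trmx_mul !mulmxA. Qed.

Lemma wedge_col q1 q2 m (U1 V1 : 'M[A]_(q1, m)) (U2 V2 : 'M[_]_(q2, m)) :
  wedge (col_mx U1 U2) (col_mx V1 V2) = wedge U1 V1 + wedge U2 V2.
Proof. by rewrite /wedge !tr_col_mx !mul_row_col opprD addrACA. Qed.

End Wedge.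

Lemma wedge00 (A : comNzRingType) q m : wedge (0 : 'M[A]_(q, m)) 0 = 0.
Proof. by rewrite /wedge mulmx0 subrr. Qed.

(** A congruence by [B] uses the pivot g to clear w and its negative transpose; swapping the first
    two rows then gives the block diagonal matrix with blocks -g, g and [Q]. *)
Lemma rank_skew_pivot (K : fieldType) m (g : K) (w : 'rV_m) (Q : 'M[_]_m) :
    g != 0 ->
  (\rank (block_mx (0 : 'M[_]_1) (row_mx g%:M 0) (- col_mx g%:M 0)
            (block_mx (0 : 'M[_]_1) w (- w^T) Q)) >= 2 + \rank Q)%N.
Proof.
move=> g0; set T := block_mx _ _ _ _.
pose Sw : 'M[K]_(1 + (1 + m)) :=
  block_mx (0 : 'M[_]_1) (row_mx 1%:M 0) (col_mx 1%:M 0)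
           (block_mx (0 : 'M[_]_1) 0 0 1%:M).
pose B : 'M[K]_(1 + (1 + m)) :=
  block_mx 1%:M (row_mx (0 : 'M[_]_1) (g^-1 *: w)) 0 1%:M.
have TB : T *m B = block_mx (0 : 'M[_]_1) (row_mx g%:M 0) (- col_mx g%:M 0)
            (block_mx (0 : 'M[_]_1) 0 (- w^T) Q).
  rewrite /T /B mulmx_block !mul0mx !mulmx0 !mulmx1 !add0r !addr0.
  congr block_mx; rewrite mulNmx mul_col_row !mulmx0 !mul0mx opp_block_mx.
  rewrite add_block_mx !oppr0 !add0r mul_scalar_mx scalerA divff// scale1r.
  by rewrite addNr.
have BTB : B^T *m (T *m B) = block_mx (0 : 'M[_]_1) (row_mx g%:M 0)
            (- col_mx g%:M 0) (block_mx (0 : 'M[_]_1) 0 0 Q).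
  rewrite TB /B tr_block_mx trmx0 !trmx1 tr_row_mx trmx0 mulmx_block.
  rewrite !mul0mx !mulmx0 !mul1mx !add0r !addr0; congr block_mx.
  rewrite mul_col_row !mulmx0 !mul0mx add_block_mx !add0r linearZ /=.
  by rewrite -scalemxAl mul_mx_scalar scalerA mulVf// scale1r subrr.
have STB : Sw *m (B^T *m (T *m B)) =
    block_mx (- g%:M : 'M[_]_1) 0 0 (block_mx (g%:M : 'M[_]_1) 0 0 Q).
  rewrite BTB /Sw mulmx_block !mul0mx !mulmx0 !add0r.
  rewrite mul_row_block mulmxN mulmxN mul_block_col mulmx_block mul_row_col.
  rewrite mul_col_row !mul0mx !mulmx0 !mul1mx ?add0r ?addr0.
  rewrite add_block_mx !add0r !addr0 row_mx0 col_mx0.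
  by rewrite oppr0.
have : (\rank (Sw *m (B^T *m (T *m B))) <= \rank T)%N.
  by rewrite !mulmxA (leq_trans (mxrankM_maxl _ _)) // mxrankM_maxr.
have rg : \rank (g%:M : 'M[_]_1) = 1%N.
  by apply: mxrank_unit; rewrite unitmxE det_scalar expr1 unitfE.
by rewrite STB !rank_diag_block_mx mxrank_opp !rg addnA.
Qed.

Lemma skew_diag (F : numFieldType) m (P : 'M[{poly F}]_m) i :
  P^T = - P -> P i i = 0.
Proof.
move=> /matrixP/(_ i i); rewrite !mxE => /polyP Pii.
apply/polyP => l; have /eqP := Pii l.
by rewrite coefN coef0 -addr_eq0 -mulr2n mulrn_eq0 => /eqP.
Qed.

(* A congruence brings the first row to the form [0, g, 0, ..., 0].  If g is
   not 0, then the second row e and the second unit vector account for all of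
   the first two rows and columns, and splitting off their wedge product
   lowers the rank by 2. *)
Lemma skew_wedge (F : numFieldType) m r (P : 'M[{poly F}]_m) :
    P^T = - P -> (\rank (map_mx (@tofrac {poly F}) P) <= 2 * r)%N ->
  exists U V : 'M[_]_(r, m), P = wedge U V.
Proof.
elim/ltn_ind: m r P => m IH r P Psk rP.
case: m IH P Psk rP => [|[|m]] IH P Psk rP.
- by exists 0, 0; apply/matrixP => -[].
- exists 0, 0; rewrite wedge00; apply/matrixP => i j.
  by rewrite !ord1 skew_diag // mxE.
move: P Psk rP; rewrite -[m.+2]/(1 + (1 + m))%N => P Psk rP.
pose p := ursubmx P.
have [V1 [g [V1u pV1]]] := row_gcd p.
pose D : 'M[_]_(1 + (1 + m)) := block_mx (1%:M : 'M[_]_1) 0 0 V1.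
have Du : D \in unitmx by rewrite block_diag_mx_unit unitmx1.
suff: forall Q, Q = D^T *m P *m D -> exists U V : 'M[_]_(r, _), Q = wedge U V.
  case/(_ _ erefl) => U [V UV].
  exists (U *m invmx D), (V *m invmx D).
  rewrite wedge_mulr -UV trmx_inv !mulmxA mulVmx ?unitmx_tr// mul1mx.
  by rewrite mulmxK.
move=> Q QE.
have rQ : (\rank (map_mx (@tofrac {poly F}) Q) <= 2 * r)%N.
  apply: leq_trans rP; rewrite QE !map_mxM.
  by rewrite (leq_trans (mxrankM_maxl _ _))// mxrankM_maxr.
pose Q' := drsubmx (Q : 'M[_]_(1 + (1 + m))).
have Qsk : Q^T = - Q.
  by rewrite QE !trmx_mul trmxK Psk mulNmx mulmxN mulmxA.
have Q'sk : Q'^T = - Q'.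
  by rewrite /Q' trmx_drsub Qsk; apply/matrixP => i j; rewrite !mxE.
have Qbl : Q = block_mx 0 (row_mx g%:M 0) (- (row_mx g%:M 0)^T) Q'.
  have Qur : ursubmx (Q : 'M[_]_(1 + (1 + m))) = row_mx g%:M 0.
    rewrite QE -[P]submxK -/p /D tr_block_mx !mulmx_block block_mxKur.
    by rewrite !trmx1 !trmx0 !mul1mx !mul0mx !mulmx0 !addr0 add0r.
  rewrite -[LHS]submxK -/Q' Qur; congr block_mx.
    apply/matrixP => i j; rewrite !ord1 [RHS]mxE 2![LHS]mxE.
    exact: skew_diag.
  by rewrite -Qur trmx_ursub Qsk; apply/matrixP => i j; rewrite !mxE opprK.
(* If g = 0, the first row and column vanish, and the smaller block is treated with the same r. *)
have [g0|g0] := eqVneq g 0.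
  have Q0 : Q = block_mx (0 : 'M[_]_1) 0 0 Q'.
    by rewrite Qbl g0 raddf0 row_mx0 trmx0 oppr0.
  have rQ' : (\rank (map_mx (@tofrac {poly F}) Q') <= 2 * r)%N.
    by move: rQ; rewrite Q0 map_block_mx !map_mx0 rank_diag_block_mx mxrank0.
  have [U [V UV]] := IH _ (ltnSn _) r Q' Q'sk rQ'.
  exists (row_mx (0 : 'M[_]_(r, 1)) U), (row_mx (0 : 'M[_]_(r, 1)) V).
  rewrite Q0 UV /wedge !tr_row_mx !mul_col_row !trmx0 !mulmx0 !mul0mx.
  by rewrite opp_block_mx add_block_mx !oppr0 !addr0.
pose w := ursubmx (Q' : 'M[_]_(1 + m)).
pose Q'' := drsubmx (Q' : 'M[_]_(1 + m)).
have Q''sk : Q''^T = - Q''.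
  by rewrite /Q'' trmx_drsub Q'sk; apply/matrixP => i j; rewrite !mxE.
have Q'E : Q' = block_mx 0 w (- w^T) Q''.
  rewrite -[LHS]submxK -/w -/Q''; congr block_mx.
    apply/matrixP => i j; rewrite !ord1 [RHS]mxE 2![LHS]mxE.
    exact: skew_diag.
  by rewrite /w trmx_ursub Q'sk; apply/matrixP => i j; rewrite !mxE opprK.
have rQ'' : (2 + \rank (map_mx (@tofrac {poly F}) Q'') <= 2 * r)%N.
  apply: leq_trans rQ.
  have gK0 : tofrac g != 0 by rewrite tofrac_eq0.
  have := rank_skew_pivot (map_mx (@tofrac {poly F}) w)
            (map_mx (@tofrac {poly F}) Q'') gK0.
  rewrite Qbl Q'E tr_row_mx tr_scalar_mx trmx0 !map_block_mx !map_mxN.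
  by rewrite map_row_mx map_col_mx !map_mx0 !map_scalar_mx map_trmx.
case: r rQ'' {rP rQ} => [|r]; first by rewrite muln0 ltn0.
rewrite mulnS leq_add2l => rQ''.
have [U [V UV]] := IH _ (leqW (leqnn _)) r Q'' Q''sk rQ''.
exists (col_mx (row_mx (0 : 'M[_]_1) (row_mx (1%:M : 'M[_]_1) 0))
               (row_mx (0 : 'M[_]_(r, 1)) (row_mx (0 : 'M[_]_(r, 1)) U))).
exists (col_mx (row_mx (- g%:M : 'M[_]_1) (row_mx (0 : 'M[_]_1) w))
               (row_mx (0 : 'M[_]_(r, 1)) (row_mx (0 : 'M[_]_(r, 1)) V))).
rewrite [RHS](@wedge_col _ 1 r) Qbl Q'E UV /wedge.
rewrite !tr_row_mx !mul_col_row !trmx0 !mulmx0 !mul0mx.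

rewrite ?tr_row_mx ?mul_col_mx ?mul_mx_row.
rewrite ?trmx0 ?trmx1 ?mulmx0 ?mul0mx ?mulmx1 ?mul1mx ?mulmxN ?mulmx1.
rewrite ?opp_block_mx ?add_block_mx ?row_mx0 ?col_mx0.
rewrite ?(oppr0, addr0, add0r).
rewrite !linearN /= !tr_scalar_mx -!scaleN1r !scale_row_mx !scale_col_mx.
by rewrite !scaler0 !scaleN1r opprK.
Qed.

(** * Degree reduction *)

Lemma wedgeE (A : comNzRingType) q m (U V : 'M[A]_(q, m)) j k :
  wedge U V j k = \sum_i (U i j * V i k - V i j * U i k).
Proof.
rewrite !mxE -sumrB; apply: eq_bigr => i _.
by rewrite !mxE.
Qed.

(* A product of elementary transformations of the symplectic group. *)
Lemma wedge_transvection (A : comNzRingType) q m (U V : 'M[A]_(q, m)) i0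
    (f h : 'I_q -> A) : f i0 = 0 ->
  wedge (\matrix_(i, j) if i == i0
           then U i0 j + \sum_l (f l * U l j + h l * V l j)
           else U i j + h i * V i0 j)
        (\matrix_(i, j) if i == i0 then V i0 j else V i j - f i * V i0 j)
  = wedge U V.
Proof.
move=> f0; apply/matrixP => j k; rewrite !wedgeE.
rewrite (bigD1 i0) //= [RHS](bigD1 i0) //= !mxE eqxx.
pose z l := \sum_(i | i != i0) (f i * U i l + h i * V i l).
have zE l : \sum_i (f i * U i l + h i * V i l) = h i0 * V i0 l + z l.
  by rewrite (bigD1 i0) //= f0 mul0r add0r.
rewrite !zE (eq_bigr (fun i => (U i j * V i k - V i j * U i k) +
   (V i0 j * (f i * U i k + h i * V i k) -
    V i0 k * (f i * U i j + h i * V i j)))); last first.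
  by move=> i /negPf ii0; rewrite !mxE ii0; ring.
rewrite big_split /= [X in _ + (_ + X) = _]sumrB -!mulr_sumr -/(z j) -/(z k).
by set S := \sum_(_ | _) _; ring.
Qed.

Lemma coef_mul_top (A : nzRingType) (p q : {poly A}) a b :
  (size p <= a.+1)%N -> (size q <= b.+1)%N -> (p * q)`_(a + b) = p`_a * q`_b.
Proof.
move=> sp sq; have a_lt : (a < (a + b).+1)%N by rewrite ltnS leq_addr.
rewrite coefM (bigD1 (Ordinal a_lt)) //= addKn big1 ?addr0 // => i ia.
have [ai|ia'] := ltnP a i; first by rewrite nth_default ?mul0r ?(leq_trans sp).
have {}ia : (i < a)%N.
  by rewrite ltn_neqAle ia' andbT; move: ia; rewrite -val_eqE.
by rewrite [q`__]nth_default ?mulr0 // (leq_trans sq) // ltn_subRL ltn_add2r.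
Qed.

Lemma size_polyM_leq (A : nzRingType) (p q : {poly A}) a b c :
  (size p <= a.+1)%N -> (size q <= b.+1)%N -> (a + b <= c)%N ->
  (size (p * q)%R <= c.+1)%N.
Proof.
move=> sp sq abc; apply: leq_trans (size_polyMleq _ _) _.
rewrite -subn1 leq_subLR add1n (leq_trans (leq_add sp sq)) //.
by rewrite addSn addnS !ltnS.
Qed.

Lemma size_leq_coef0 (A : nzRingType) (p : {poly A}) a :
  (size p <= a.+1)%N -> p`_a = 0 -> (size p <= a)%N.
Proof.
move=> /leq_sizeP sp pa; apply/leq_sizeP => l.
by rewrite leq_eqVlt => /orP[/eqP <-|/sp].
Qed.

Section DegreeReduction.
Variables (F : fieldType) (r m : nat).
Implicit Types (U V : 'M[{poly F}]_(r, m)) (a b : 'I_r -> nat).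

Definition row_degrees_le U a := forall i j, (size (U i j) <= (a i).+1)%N.

(** As s > d, the terms of degree s cancel, so the leading coefficient matrices satisfy
    [wedge LU LV = 0]. If row [i0] of [LU] is a combination of the other rows of [LU] and the rows
    of [LV], a transvection cancels the top coefficients of row [i0] of [U]. Otherwise row [i0] of
    [LV] is zero. *)
Lemma wedge_degree_step U V a b d s i0 :
    row_degrees_le U a -> row_degrees_le V b ->
    (forall j k, (size (wedge U V j k) <= d.+1)%N) -> (d < s)%N ->
    (forall i, (a i + b i <= s)%N) -> (forall i, (b i <= a i)%N) ->
    (a i0 + b i0 = s)%N -> (forall i, (a i + b i = s)%N -> (a i <= a i0)%N) ->
  exists U' V', [/\ wedge U' V' = wedge U V,
    row_degrees_le U' a, row_degrees_le V' b &
    (forall j, (size (U' i0 j) <= a i0)%N) \/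
    (forall j, (size (V' i0 j) <= b i0)%N)].
Proof.
move=> Ua Vb Wd ds abs ba ab0 amax.
(* Rows with a i + b i < s do not contribute to the coefficient of degree s and are replaced by
   0. *)
pose LU := \matrix_(i, j) if (a i + b i == s)%N then (U i j)`_(a i) else 0.
pose LV := \matrix_(i, j) if (a i + b i == s)%N then (V i j)`_(b i) else 0.
have coefs (c c' : 'I_r -> nat) (X Y : 'M[{poly F}]_(r, m)) i j k :
    (size (X i j) <= (c i).+1)%N -> (size (Y i k) <= (c' i).+1)%N ->
    (c i + c' i <= s)%N ->
  (X i j * Y i k)`_s =
  if (c i + c' i == s)%N then (X i j)`_(c i) * (Y i k)`_(c' i) else 0.
  move=> sX sY; case: eqP => [<- _|/eqP ne le]; first exact: coef_mul_top.
  rewrite nth_default // (leq_trans (size_polyM_leq sX sY (leqnn _))) //.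
  by rewrite ltn_neqAle ne.
have LW : wedge LU LV = 0.
  apply/matrixP => j k; rewrite wedgeE mxE.
  rewrite -[RHS](_ : (wedge U V j k)`_s = 0); last first.
    by rewrite nth_default // (leq_trans (Wd _ _)).
  rewrite wedgeE coef_sum; apply: eq_bigr => i _; rewrite coefB.
  rewrite (coefs a b) // (coefs b a) // 1?addnC // !mxE addnC.
  by case: ifP; rewrite ?mul0r ?subrr // addnC.
pose LU' := \matrix_(i, j) if i == i0 then 0 else LU i j.
have [/submxP[D LUD]|nsub] := boolP (row i0 LU <= col_mx LU' LV)%MS; last first.
  exists U, V; split=> //; right.
  have [j0 zj0] : exists j0, (row i0 LU *m cokermx (col_mx LU' LV)) 0 j0 != 0.
    move: nsub; rewrite submxE => /eqP nsub; apply: contrapT => nj.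
    apply: nsub; apply/rowP => j; rewrite [RHS]mxE.
    by apply: contrapT => hj; apply: nj; exists j; apply/eqP.
  (* [z] is annihilated by [LU'] and [LV] but not by row [i0] of [LU]; applying [wedge LU LV = 0] to
     it leaves a nonzero multiple of row [i0] of [LV]. *)
  pose z := col j0 (cokermx (col_mx LU' LV)).
  have Nz : col_mx LU' LV *m z = 0.
    by rewrite /z colE mulmxA mulmx_coker mul0mx.
  move: Nz; rewrite mul_col_mx -[0]vsubmxK => /eq_col_mx[LUz LVz].
  have LUzE : LU *m z = (row i0 LU *m z) 0 0 *: delta_mx i0 0.
    apply/colP => i; rewrite !mxE eqxx andbT; case: eqP => [->|/eqP ii0].
      by rewrite mulr1; apply: eq_bigr => j _; rewrite !mxE.
    rewrite mulr0; transitivity ((LU' *m z) i 0); last by rewrite LUz !mxE.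
    rewrite [RHS]mxE; apply: eq_bigr => j _.
    by rewrite [LU' i j]mxE (negPf ii0).
  have c0 : (row i0 LU *m z) 0 0 != 0.
    by rewrite /z colE mulmxA -colE mxE.
  have LV0 : row i0 LV = 0.
    have := congr1 (fun X => X *m z) LW.
    rewrite mul0mx /wedge mulmxBl -!mulmxA LUzE LVz linear0 mulmx0 sub0r.
    rewrite -scalemxAr => /eqP; rewrite oppr_eq0 scaler_eq0 (negPf c0) /=.
    rewrite -colE => /eqP/colP LV0; apply/rowP => j.
    by have := LV0 j; rewrite !mxE.
  move=> j; apply: size_leq_coef0 => //.
  by move/rowP: LV0 => /(_ j); rewrite !mxE ab0 eqxx.
pose x := lsubmx D; pose y := rsubmx D.
(* The powers of X raise each row involved to degree [a i0]; the exponents are true differences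
   because [a i <= a i0] and [b i <= a i] on these rows. The other rows that the transvection alters
   keep their bounds: for instance a i0 - b i + b i0 = s - b i = a i. *)
pose f i : {poly F} := if (i != i0) && (a i + b i == s)%N
  then - x 0 i *: 'X^(a i0 - a i) else 0.
pose h i : {poly F} := if (a i + b i == s)%N
  then - y 0 i *: 'X^(a i0 - b i) else 0.
have sX (c : F) n : (size (c *: 'X^n : {poly F}) <= n.+1)%N.
  by rewrite (leq_trans (size_scale_leq _ _)) // size_polyXn.
have f0 : f i0 = 0 by rewrite /f eqxx.
have fU l j : (size (f l * U l j)%R <= (a i0).+1)%N.
  rewrite /f; case: andP => [[_ /eqP abl]|_]; last by rewrite mul0r size_poly0.
  by apply: size_polyM_leq (sX _ _) (Ua _ _) _; rewrite subnK // amax.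
have hV l j : (size (h l * V l j)%R <= (a i0).+1)%N.
  rewrite /h; case: eqP => [abl|_]; last by rewrite mul0r size_poly0.
  apply: size_polyM_leq (sX _ _) (Vb _ _) _; rewrite subnK //.
  exact: leq_trans (ba l) (amax _ abl).
have le0 i : (a i + b i = s)%N -> (b i <= a i0)%N.
  by move=> abi; exact: leq_trans (ba i) (amax _ abi).
eexists _, _; split; first exact: (wedge_transvection U V h f0).
- move=> i j; rewrite mxE; case: eqP => [->|/eqP ii0].
    rewrite (leq_trans (size_polyD _ _)) // geq_max Ua /=.
    apply: leq_trans (size_sum _ _ _) _; apply/bigmax_leqP => l _.
    by rewrite (leq_trans (size_polyD _ _)) // geq_max fU hV.
  rewrite (leq_trans (size_polyD _ _)) // geq_max Ua /=.
  rewrite /h; case: eqP => [abi|_]; last by rewrite mul0r size_poly0.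
  apply: size_polyM_leq (sX _ _) (Vb _ _) _.
  by rewrite -(leq_add2r (b i)) addnAC subnK ?le0 // ab0 -abi.
- move=> i j; rewrite mxE; case: eqP => [->|/eqP ii0] //.
  rewrite (leq_trans (size_polyD _ _)) // size_polyN geq_max Vb /=.
  rewrite /f ii0 /=; case: eqP => [abi|_]; last by rewrite mul0r size_poly0.
  apply: size_polyM_leq (sX _ _) (Vb _ _) _.
  by rewrite -(leq_add2r (a i)) addnAC subnK ?amax // ab0 -abi addnC.
left=> j; rewrite mxE eqxx; apply: size_leq_coef0.
  rewrite (leq_trans (size_polyD _ _)) // geq_max Ua /=.
  apply: leq_trans (size_sum _ _ _) _; apply/bigmax_leqP => l _.
  by rewrite (leq_trans (size_polyD _ _)) // geq_max fU hV.
rewrite coefD coef_sum.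
have topX (c : F) n p e :
    (n + e = a i0)%N -> (c *: 'X^n * p)`_(a i0) = c * p`_e.
  move=> <-; rewrite -scalerAl coefZ [_ * p]mulrC coefMXn.
  by rewrite ltnNge leq_addr addKn.
have LU0 : (U i0 j)`_(a i0) = LU i0 j by rewrite mxE ab0 eqxx.
have -> : (U i0 j)`_(a i0) = \sum_l (x 0 l * LU' l j + y 0 l * LV l j).
  have -> : (U i0 j)`_(a i0) = row i0 LU 0 j by rewrite LU0 [RHS]mxE.
  rewrite LUD -[D]hsubmxK mul_row_col -/x -/y mxE.
  by rewrite [X in X + _]mxE [X in _ + X]mxE big_split.
rewrite -big_split big1 // => l _ /=; rewrite coefD /f /h !mxE.
case: (eqVneq l i0) => [->|ll0] /=.
  rewrite ab0 eqxx mul0r coef0 mulr0 !add0r.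
  by rewrite (topX _ _ _ (b i0)) ?subnK // mulNr subrr.
case: eqP => [abl|_]; last by rewrite !mul0r !coef0 !mulr0 !addr0.
rewrite (topX _ _ (U l j) (a l)) ?(topX _ _ (V l j) (b l)) ?subnK ?amax ?le0 //.
by rewrite !mulNr; ring.
Qed.


(** Uses u ^ v = v ^ (-u) in the rows where the bound for [V] is the larger one. *)
Lemma wedge_swap U V a b :
    row_degrees_le U a -> row_degrees_le V b ->
  exists U' V' a' b', [/\ wedge U' V' = wedge U V, row_degrees_le U' a',
    row_degrees_le V' b', (forall i, (a' i + b' i = a i + b i)%N) &
    forall i, (b' i <= a' i)%N].
Proof.
move=> Ua Vb; pose s i := (a i < b i)%N.
exists (\matrix_(i, j) if s i then V i j else U i j).
exists (\matrix_(i, j) if s i then - U i j else V i j).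
exists (fun i => if s i then b i else a i).
exists (fun i => if s i then a i else b i); split.
- apply/matrixP => j k; rewrite !wedgeE; apply: eq_bigr => i _; rewrite !mxE.
  by case: (s i); ring.
- by move=> i j; rewrite mxE; case: (s i).
- by move=> i j; rewrite mxE; case: (s i); rewrite ?size_polyN.
- by move=> i; case: (s i); rewrite // addnC.
- by move=> i; case: ifP => [/ltnW//|/negbT]; rewrite -leqNgt.
Qed.

(** Induction on the sum of all degree bounds. While some a i + b i exceeds d, [wedge_degree_step]
    is applied at a row with maximal a i + b i and, among those, maximal a i. *)
Lemma wedge_degree_reduction U V a b d :
    row_degrees_le U a -> row_degrees_le V b ->
    (forall j k, (size (wedge U V j k) <= d.+1)%N) ->
  exists U' V' a' b', [/\ wedge U' V' = wedge U V, row_degrees_le U' a',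
    row_degrees_le V' b' & forall i, (a' i + b' i <= d)%N].
Proof.
have [n] := ubnP (\sum_i (a i + b i)); elim: n U V a b => // n IH U V a b.
rewrite ltnS => abn Ua Vb Wd.
have [U1 [V1 [a1 [b1 [W1 U1a V1b ab1 ba1]]]]] := wedge_swap Ua Vb.
rewrite -W1 in Wd *; have {abn} abn : (\sum_i (a1 i + b1 i) <= n)%N.
  by rewrite (eq_bigr _ (fun i _ => ab1 i)).
move: U1 V1 a1 b1 {W1 ab1} U1a V1b ba1 abn Wd => {Ua Vb}{}U {}V {}a {}b.
move=> Ua Vb ba abn Wd.
have [abd|] := boolP [forall i, a i + b i <= d]%N.
  by exists U, V, a, b; split=> // i; exact: (forallP abd).
move=> /forallPn[i1]; rewrite -ltnNge => di1.
have [/= i2 _ i2max] := @arg_maxnP _ i1 xpredT (fun i => a i + b i)%N isT.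
pose s := (a i2 + b i2)%N.
have ds : (d < s)%N by apply: leq_trans di1 (i2max _ _).
have [/= i0 /eqP i0s i0max] :=
  @arg_maxnP _ i2 (fun i => a i + b i == s)%N a (eqxx _).
have a0 : (0 < a i0)%N.
  rewrite lt0n; apply: contraTneq ds => a00.
  by rewrite -i0s a00 add0n -leqNgt (leq_trans (ba _)) // a00.
have [U' [V' [W' U'a V'b red]]] := wedge_degree_step Ua Vb Wd ds
  (fun i => i2max i isT) ba i0s (fun i ais => i0max i (introT eqP ais)).
suff [U2 [V2 [a2 [b2 [W2 U2a V2b lt2]]]]] : exists U2 V2 a2 b2,
    [/\ wedge U2 V2 = wedge U V, row_degrees_le U2 a2, row_degrees_le V2 b2 &
        (\sum_i (a2 i + b2 i) < \sum_i (a i + b i))%N].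
  rewrite -W2 in Wd *; apply: IH U2a V2b Wd.
  exact: leq_trans lt2 abn.
have lt_sum (a' b' : 'I_r -> nat) : (a' i0 + b' i0 < a i0 + b i0)%N ->
    (forall i, i != i0 -> a' i + b' i = a i + b i)%N ->
    (\sum_i (a' i + b' i) < \sum_i (a i + b i))%N.
  move=> lt0 eq0; rewrite (bigD1 i0) //= [X in (_ < X)%N](bigD1 i0) //=.
  by rewrite (eq_bigr _ eq0) ltn_add2r.
case: red => [U'0|V'0].
  exists U', V', (fun i => if i == i0 then (a i0).-1 else a i), b; split=> //.
    by move=> i j; case: eqP => [->|_] //; rewrite prednK.
  apply: lt_sum => [|i /negPf ->] //; rewrite eqxx ltn_add2r.
  by rewrite prednK.
(* When [b i0] is 0 it cannot decrease, but row [i0] of [V'] is then zero. So row [i0] of [U'] may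
   be replaced by 0, and the positive bound [a i0] drops to 0 instead. *)
have [b0|b0] := posnP (b i0).
  exists (\matrix_(i, j) if i == i0 then 0 else U' i j), V'.
  exists (fun i => if i == i0 then 0%N else a i), b; split=> //.
  - rewrite -W'; apply/matrixP => j k; rewrite !wedgeE; apply: eq_bigr => i _.
    rewrite !mxE; case: eqP => [->|//].
    have V0 l : V' i0 l = 0.
      by apply/eqP; rewrite -size_poly_eq0 -leqn0 -b0.
    by rewrite !V0; ring.
  - by move=> i j; rewrite mxE; case: eqP => // _; rewrite size_poly0.
  - by apply: lt_sum => [|i /negPf ->] //; rewrite eqxx ltn_add2r.
exists U', V', a, (fun i => if i == i0 then (b i0).-1 else b i); split=> //.
  by move=> i j; case: eqP => [->|_] //; rewrite prednK.
apply: lt_sum => [|i /negPf ->] //; rewrite eqxx ltn_add2l.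
by rewrite prednK.
Qed.

End DegreeReduction.

(** * Coefficient matrices *)

Definition mxsize_le (A : nzSemiRingType) q m N (B : 'M[{poly A}]_(q, m)) :=
  forall i j, (size (B i j) <= N)%N.

Section Encoding.
Variable F : fieldType.

(** Flattening the first N coefficients into one row over [F] makes ranks and kernels over [F]
    available. Higher coefficients are dropped, so [decm] inverts [encm] only under
    [mxsize_le N]. *)
Definition encm q m N (B : 'M[{poly F}]_(q, m)) : 'M[F]_(q, m * N) :=
  \matrix_(i < q) mxvec (\matrix_(j < m, l < N) (B i j)`_l).

Definition decm q m N (A : 'M[F]_(q, m * N)) : 'M[{poly F}]_(q, m) :=
  \matrix_(i, j) rVpoly (row j (vec_mx (row i A))).

Lemma encmE q m N (B : 'M[{poly F}]_(q, m)) i j (l : 'I_N) :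
  encm N B i (mxvec_index j l) = (B i j)`_l.
Proof. by rewrite mxE mxvecE mxE. Qed.

Lemma coef_decm q m N (A : 'M[F]_(q, m * N)) i j (l : 'I_N) :
  (decm A i j)`_l = A i (mxvec_index j l).
Proof. by rewrite mxE coef_rVpoly_ord !mxE. Qed.

Lemma size_decm q m N (A : 'M[F]_(q, m * N)) : mxsize_le N (decm A).
Proof. by move=> i j; rewrite mxE size_poly. Qed.

Lemma mxvec_eqP q m N (A B : 'M[F]_(q, m * N)) :
  (forall i j l, A i (mxvec_index j l) = B i (mxvec_index j l)) -> A = B.
Proof. by move=> AB; apply/matrixP => i c; case/mxvec_indexP: c. Qed.

Lemma mxsize_eqP q m N (A B : 'M[{poly F}]_(q, m)) :
    mxsize_le N A -> mxsize_le N B ->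
  (forall i j (l : 'I_N), (A i j)`_l = (B i j)`_l) -> A = B.
Proof.
move=> sA sB AB; apply/matrixP => i j; apply/polyP => l.
have [lN|Nl] := ltnP l N; first exact: (AB i j (Ordinal lN)).
by rewrite !nth_default ?(leq_trans (sA _ _)) ?(leq_trans (sB _ _)).
Qed.

Lemma decmK q m N : cancel (@decm q m N) (@encm q m N).
Proof. by move=> A; apply: mxvec_eqP => i j l; rewrite encmE coef_decm. Qed.

Lemma encmK q m N (B : 'M[{poly F}]_(q, m)) :
  mxsize_le N B -> decm (encm N B) = B.
Proof.
move=> sB; apply: mxsize_eqP sB _ => [|i j l]; first exact: size_decm.
by rewrite coef_decm encmE.
Qed.

Lemma encm_eq0 q m N (B : 'M[{poly F}]_(q, m)) :
  mxsize_le N B -> encm N B = 0 -> B = 0.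
Proof.
move=> sB B0; apply: mxsize_eqP sB _ _ => [i j|i j l].
  by rewrite mxE size_poly0.
by rewrite -encmE B0 !mxE coef0.
Qed.

Lemma encmM p q m N (D : 'M[F]_(p, q)) (B : 'M[{poly F}]_(q, m)) :
  encm N (map_mx polyC D *m B) = D *m encm N B.
Proof.
apply: mxvec_eqP => i j l; rewrite encmE !mxE coef_sum; apply: eq_bigr => k _.
by rewrite encmE mxE coefCM.
Qed.

Lemma decmM p q m N (D : 'M[F]_(p, q)) (A : 'M[F]_(q, m * N)) :
  decm (D *m A) = map_mx polyC D *m decm A.
Proof.
rewrite -[A in LHS]decmK -encmM encmK // => i j; rewrite mxE.
apply: leq_trans (size_sum _ _ _) _; apply/bigmax_leqP => k _.
by rewrite mxE mul_polyC (leq_trans (size_scale_leq _ _)) ?size_decm.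
Qed.

Lemma encmD q m N (B B' : 'M[{poly F}]_(q, m)) :
  encm N (B + B') = encm N B + encm N B'.
Proof. by apply: mxvec_eqP => i j l; rewrite [RHS]mxE !encmE mxE coefD. Qed.

Lemma encmZ q m N c (B : 'M[{poly F}]_(q, m)) :
  encm N (c%:P *: B) = c *: encm N B.
Proof. by apply: mxvec_eqP => i j l; rewrite [RHS]mxE !encmE mxE coefCM. Qed.

Lemma decm0 q m N : decm (0 : 'M[F]_(q, m * N)) = 0.
Proof. by apply/matrixP => i j; rewrite !mxE !linear0. Qed.

Lemma mxsize_mul q m p N k (A : 'M[{poly F}]_(q, m)) (B : 'M[_]_(m, p)) :
  mxsize_le N A -> mxsize_le k.+1 B -> mxsize_le (N + k) (A *m B).
Proof.
move=> sA sB i j; rewrite mxE; apply: leq_trans (size_sum _ _ _) _.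
apply/bigmax_leqP => l _; apply: leq_trans (size_polyMleq _ _) _.
by rewrite -subn1 leq_subLR add1n -addnS leq_add.
Qed.

Lemma mxsize_tr q m N (A : 'M[{poly F}]_(q, m)) :
  mxsize_le N A -> mxsize_le N A^T.
Proof. by move=> sA i j; rewrite mxE. Qed.

End Encoding.

(** * Multiplication by the factors on polynomial vectors of bounded degree *)

Section SyndromeMatrix.
Variables (F : fieldType) (r m k : nat).
Implicit Types (U V : 'M[{poly F}]_(r, m)) (N : nat).

(* The matrix of y |-> (y U^T, y V^T) on row vectors of polynomials of size at
   most N, where the entries of U and V have degree at most k and k + 1. *)
Definition synmx N U V : 'M[F]_(m * N, r * (N + k) + r * (N + k.+1)) :=
  row_mx (encm (N + k) (decm (1%:M : 'M[_]_(m * N)) *m U^T))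
         (encm (N + k.+1) (decm (1%:M : 'M[_]_(m * N)) *m V^T)).

Lemma mul_synmx q N (A : 'M[_]_(q, m * N)) U V :
  A *m synmx N U V =
  row_mx (encm (N + k) (decm A *m U^T)) (encm (N + k.+1) (decm A *m V^T)).
Proof. by rewrite mul_mx_row -!encmM !mulmxA -!decmM mulmx1. Qed.

Lemma synmxD N U V U' V' c :
  synmx N (U + c%:P *: U') (V + c%:P *: V') = synmx N U V + c *: synmx N U' V'.
Proof.
rewrite /synmx scale_row_mx add_row_mx -!encmZ -!encmD.
by rewrite !linearD /= !linearZ.
Qed.

Section Sizes.
Variables (U V : 'M[{poly F}]_(r, m)).
Hypotheses (sU : mxsize_le k.+1 U) (sV : mxsize_le k.+2 V).

Lemma synmx_eq0 q N (A : 'M[_]_(q, m * N)) :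
  A *m synmx N U V = 0 <-> decm A *m U^T = 0 /\ decm A *m V^T = 0.
Proof.
rewrite mul_synmx; split=> [|[-> ->]].
  rewrite -[0]hsubmxK !linear0 => /eq_row_mx[AU AV].
  by split; [apply: encm_eq0 AU | apply: encm_eq0 AV];
    apply: mxsize_mul (size_decm _) _; apply: mxsize_tr.
by apply/eqP; rewrite -row_mx0; apply/eqP; congr row_mx;
  apply: mxvec_eqP => i j l; rewrite encmE !mxE coef0.
Qed.

Lemma synmx_free N : row_free (synmx N U V) <->
  (forall y : 'rV_m, mxsize_le N y -> y *m U^T = 0 -> y *m V^T = 0 -> y = 0).
Proof.
split=> [fr y sy yU yV|inj].
  have : encm N y *m synmx N U V = 0 by apply/synmx_eq0; rewrite encmK.
  move/eqP; rewrite mulmx_free_eq0 // => /eqP; exact: encm_eq0.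
apply: inj_row_free => v /synmx_eq0[vU vV].
apply: (can_inj (@decmK _ _ _ _)); rewrite decm0.
by apply: inj => //; exact: size_decm.
Qed.

Lemma synmx_full N : row_full (synmx N U V) <->
  (forall h1 h2 : 'rV_r, mxsize_le (N + k) h1 -> mxsize_le (N + k.+1) h2 ->
   exists y : 'rV_m, [/\ mxsize_le N y, y *m U^T = h1 & y *m V^T = h2]).
Proof.
split=> [/row_fullP[B BS] h1 h2 s1 s2|sur].
  exists (decm (row_mx (encm _ h1) (encm _ h2) *m B)).
  split; first exact: size_decm.
    have := mul_synmx (row_mx (encm _ h1) (encm _ h2) *m B) U V.
    rewrite -mulmxA BS mulmx1 => /eq_row_mx[/(congr1 (@decm _ _ _ _)) E _].
    rewrite !encmK // in E; apply: mxsize_mul (size_decm _) _.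
    exact: mxsize_tr.
  have := mul_synmx (row_mx (encm _ h1) (encm _ h2) *m B) U V.
  rewrite -mulmxA BS mulmx1 => /eq_row_mx[_ /(congr1 (@decm _ _ _ _)) E].
  rewrite !encmK // in E; apply: mxsize_mul (size_decm _) _.
  exact: mxsize_tr.
rewrite -sub1mx; apply/rV_subP => w _.
have [y [sy yU yV]] := sur _ _ (size_decm (lsubmx w)) (size_decm (rsubmx w)).
apply/submxP; exists (encm N y).
by rewrite mul_synmx encmK // yU yV !decmK hsubmxK.
Qed.

End Sizes.
End SyndromeMatrix.

(** With [B] a right inverse at s0, the polynomial det((A0 + s A1) B) takes the value 1 at s0, and
    wherever it is nonzero a right inverse exists. *)
Lemma row_free_generic (F : fieldType) p q (A0 A1 : 'M[F]_(p, q)) s0 :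
  row_free (A0 + s0 *: A1)%R ->
  exists2 D : {poly F}, D != 0 &
    forall s, D.[s] != 0 -> row_free (A0 + s *: A1)%R.
Proof.
case/row_freeP => B AB.
pose D := \det ((map_mx polyC A0 + 'X *: map_mx polyC A1) *m map_mx polyC B).
have DE s : D.[s] = \det ((A0 + s *: A1) *m B).
  have evK n m (A : 'M[F]_(n, m)) :
      map_mx (horner_eval s) (map_mx polyC A) = A.
    by apply/matrixP => i j; rewrite !mxE /horner_eval hornerC.
  rewrite -[LHS]/(horner_eval s D) -det_map_mx map_mxM map_mxD map_mxZ !evK.
  by rewrite /= /horner_eval hornerX.
exists D => [|s].
  apply: contra_eq_neq (DE s0) => ->.
  by rewrite horner0 AB det1 eq_sym oner_eq0.
rewrite DE => Ds; apply/row_freeP; exists (B *m invmx ((A0 + s *: A1) *m B)).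
by rewrite mulmxA mulmxV // unitmxE unitfE.
Qed.

Lemma row_full_generic (F : fieldType) p q (A0 A1 : 'M[F]_(p, q)) s0 :
  row_full (A0 + s0 *: A1)%R ->
  exists2 D : {poly F}, D != 0 &
    forall s, D.[s] != 0 -> row_full (A0 + s *: A1)%R.
Proof.
have full_tr s : row_full (A0 + s *: A1)%R = row_free (A0^T + s *: A1^T)%R.
  suff -> : A0^T + s *: A1^T = (A0 + s *: A1)^T.
    by rewrite /row_full /row_free mxrank_tr.
  by apply/matrixP => i j; rewrite !mxE.
rewrite full_tr => /row_free_generic[D D0 Ds].
by exists D => // s /Ds; rewrite full_tr.
Qed.

(** * Generic factors exist *)

Section Windows.
Variable F : fieldType.
Implicit Types (c : nat -> nat) (g : nat -> {poly F}).

Lemma XnM_addr_eq0 n (p q : {poly F}) :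
  (size p <= n)%N -> p + 'X^n * q = 0 -> p = 0 /\ q = 0.
Proof.
move=> sp pq; have : drop_poly n (p + q * 'X^n) = 0.
  by rewrite mulrC pq drop_poly0r.
rewrite drop_polyDMXn // => q0; move: pq.
by rewrite q0 mulr0 addr0.
Qed.

(** The windows [c l, c l + N) are pairwise disjoint, so the monomials of different summands cannot
    cancel; the top summand is split off first. *)
Lemma window_free n c N g :
    (forall l, (l < n)%N -> (c l + N <= c l.+1)%N) ->
    (forall l, (l <= n)%N -> (size (g l) <= N)%N) ->
  \sum_(l < n.+1) 'X^(c l) * g l = 0 -> forall l, (l <= n)%N -> g l = 0.
Proof.
elim: n => [|n IH] gap sg.
  rewrite big_ord1 => /eqP; rewrite mulf_eq0 expf_eq0 polyX_eq0 andbF /=.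
  by move=> /eqP g0 [].
rewrite big_ord_recr /= => /XnM_addr_eq0[|S0 g0 l].
  apply: leq_trans (size_sum _ _ _) _; apply/bigmax_leqP => l _.
  have le i : (i <= n - l)%N -> (c l + N <= c (l + i).+1)%N.
    elim: i => [|i IHi] le_i; first by rewrite addn0 gap // ltnW // ltn_ord.
    have lt : ((l + i).+1 < n.+1)%N by have := ltn_ord l; lia.
    by rewrite addnS; have := IHi (ltnW le_i); have := gap _ lt; lia.
  have ln : (l <= n)%N by have := ltn_ord l; lia.
  have := le (n - l)%N (leqnn _); rewrite subnKC //.
  apply: leq_trans.
  have [->|gl0] := eqVneq (g l) 0; first by rewrite mulr0 size_poly0.
  by rewrite mulrC size_mulXn // leq_add2l sg // ltnW.
rewrite leq_eqVlt => /predU1P[-> //|]; rewrite ltnS; apply: IH => //.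
  by move=> i ni; apply: gap; exact: ltnW.
by move=> i ni; apply: sg; exact: leqW.
Qed.

(** The windows leave no gap between 0 and c n + N. The part of [H] from the last cut upwards goes
    to the last window, and the rest is covered by induction. *)
Lemma window_cover n c N (H : {poly F}) :
    c 0%N = 0%N -> (forall l, (l < n)%N -> (c l.+1 <= c l + N)%N) ->
    (size H <= c n + N)%N ->
  exists g, (forall l, (size (g l) <= N)%N) /\
            H = \sum_(l < n.+1) 'X^(c l) * g l.
Proof.
move=> c0; elim: n H => [|n IH] H gap sH.
  exists (fun=> H); split=> [_|]; first by rewrite c0 in sH.
  by rewrite big_ord1 c0 mul1r.
have [||g [sg HE]] := IH (take_poly (c n.+1) H).
- by move=> l ln; apply: gap; exact: ltnW.
- by rewrite (leq_trans (size_take_poly _ _)) // gap.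
exists (fun l => if l == n.+1 then drop_poly (c n.+1) H else g l); split.
  by move=> l; case: eqP => // _; rewrite size_drop_poly leq_subLR.
rewrite big_ord_recr /= eqxx -[LHS](poly_take_drop (c n.+1)) [in LHS]HE mulrC.
congr (_ + _); apply: eq_bigr => l _.
by rewrite ltn_eqF // ltnS ltnW // ltnS.
Qed.

End Windows.

(** * Zigzag matrices *)

Section Zigzag.
Variables (F : fieldType) (q n : nat) (p c : nat -> nat) (tau : nat -> nat).
Hypotheses (p0 : p 0%N = 0%N) (p_nd : forall i, (p i <= p i.+1)%N).
Hypothesis tau_lt : forall l, (l <= n)%N -> (tau l <= q)%N.
Hypothesis p_tau : forall l, (l <= n)%N -> (p (tau l) <= c l <= p (tau l).+1)%N.

(* Row rho of the zigzag matrix corresponds to the interval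
   [p rho, p (rho + 1)].  Column j < q corresponds to the cut p (j + 1), and
   column q + l to the cut c l, which lies in the interval number tau l.
   Multiplying row rho by X^(p rho) makes the contributions of the first q
   columns telescope, so that what matters is how the windows [c l, c l + N)
   cover the exponents. *)
Definition zigzag (rho j : nat) : {poly F} :=
  if (j < q)%N then
    (if j == rho then 'X^(p rho.+1 - p rho) else 0) - (j.+1 == rho)%:R
  else if tau (j - q) == rho then 'X^(c (j - q) - p rho) else 0.

Lemma size_zigzag rho j : (j <= q + n)%N ->
  (size (zigzag rho j) <= (p rho.+1 - p rho).+1)%N.
Proof.
move=> jqn; rewrite /zigzag; case: ltnP => qj.
  rewrite (leq_trans (size_polyD _ _)) // size_polyN geq_max; apply/andP; split.
    by case: ifP; rewrite ?size_polyXn ?size_poly0.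
  by case: (_ == _); rewrite ?size_poly1 ?size_poly0.
case: eqP => [<-|_]; last by rewrite size_poly0.
have [|_ le] := andP (@p_tau (j - q) _); first by rewrite leq_subLR.
by rewrite size_polyXn ltnS leq_sub2r.
Qed.

Lemma sum_ord_if (G : nat -> {poly F}) a b :
  \sum_(j < a) (if j == b :> nat then G j else 0) =
  if (b < a)%N then G b else 0.
Proof. by rewrite -big_mkcond; exact: big_ord1_eq. Qed.

Section Row.
Variable y : nat -> {poly F}.

(** The coordinate attached to the cut p i. Its value 0 at i = 0 and i = q + 1 makes the telescoping
    sum over the rows vanish. *)
Definition cut_coord i := if (0 < i <= q)%N then y i.-1 else 0.
Local Notation f := cut_coord.

Lemma zigzag_row rho : (rho <= q)%N ->
  'X^(p rho) * (\sum_(j < q + n.+1) y j * zigzag rho j) =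
  'X^(p rho.+1) * f rho.+1 - 'X^(p rho) * f rho +
  \sum_(l < n.+1 | tau l == rho) 'X^(c l) * y (q + l)%N.
Proof.
move=> rq; rewrite big_split_ord /= mulrDr; congr (_ + _); last first.
  rewrite mulr_sumr [RHS]big_mkcond /=; apply: eq_bigr => l _.
  rewrite /zigzag ltnNge leq_addr /= addKn; case: eqP => [<-|_]; last first.
    by rewrite !mulr0.
  have [le _] := andP (p_tau (ltn_ord l : (l <= n)%N)).
  by rewrite mulrCA -exprD subnKC // mulrC.
transitivity ('X^(p rho) * (\sum_(j < q) (if j == rho :> nat then
    y j * 'X^(p rho.+1 - p rho) else 0) -
    \sum_(j < q) if j.+1 == rho then y j else 0)).
  congr (_ * _); rewrite -sumrB; apply: eq_bigr => j _.
  rewrite /zigzag ltn_ord mulrBr; congr (_ - _).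
    by case: eqP; rewrite ?mulr0.
  by case: eqP; rewrite ?mulr0 ?mulr1.
rewrite mulrBr; congr (_ - _ * _).
  rewrite /cut_coord /= (sum_ord_if (fun j => y j * _)).
  case: ltnP => _; last by rewrite !mulr0.
  by rewrite mulrCA -exprD subnKC // mulrC.
case: rho rq => [|rho] rq; rewrite /cut_coord /=; first by rewrite big1.
under eq_bigr => j _ do rewrite eqSS.
by rewrite sum_ord_if rq.
Qed.

Lemma zigzag_rows :
  \sum_(rho < q.+1) 'X^(p rho) * (\sum_(j < q + n.+1) y j * zigzag rho j) =
  \sum_(l < n.+1) 'X^(c l) * y (q + l)%N.
Proof.
rewrite (eq_bigr _ (fun (rho : 'I_q.+1) _ =>
  zigzag_row (ltn_ord rho : (rho <= q)%N))).
rewrite big_split /= -(big_mkord xpredT (fun i =>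
  'X^(p i.+1) * f i.+1 - 'X^(p i) * f i)).
rewrite (telescope_sumr (fun i => 'X^(p i) * f i)) // /cut_coord ltnn /=.
rewrite !mulr0 subrr add0r.
rewrite (exchange_big_dep xpredT) //=; apply: eq_bigr => l _.
by rewrite (big_pred1 (Ordinal (tau_lt (ltn_ord l) : (tau l < q.+1)%N))).
Qed.

End Row.

(** By [zigzag_rows] the sum of the windows is 0, and disjointness kills the last n + 1 coordinates.
    The rows, read from the top, then kill the cut coordinates one after the other. *)
Lemma zigzag_free N (y : nat -> {poly F}) :
    (forall l, (l < n)%N -> (c l + N <= c l.+1)%N) ->
    (forall j, (size (y j) <= N)%N) ->
    (forall rho, (rho <= q)%N -> \sum_(j < q + n.+1) y j * zigzag rho j = 0) ->
  forall j, (j < q + n.+1)%N -> y j = 0.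
Proof.
move=> gap sy y0.
have g0 l : (l <= n)%N -> y (q + l)%N = 0.
  apply: (@window_free F n c N (fun l => y (q + l)%N)) => //.
  rewrite -zigzag_rows big1 // => rho _; rewrite y0 ?mulr0 //.
  exact: (ltn_ord rho).
have f0 i : (i <= q)%N -> cut_coord y i = 0.
  elim: i => [|i IH iq]; first by [].
  have := zigzag_row y (ltnW iq).
  rewrite y0 ?(ltnW iq) // mulr0 (IH (ltnW iq)) mulr0 subr0.
  rewrite [X in _ + X]big1 ?addr0 => [/esym/eqP|l _]; last first.
    by rewrite g0 ?mulr0 //; exact: (ltn_ord l).
  by rewrite mulf_eq0 expf_eq0 polyX_eq0 andbF /= => /eqP.
move=> j jqn; have [jq|qj] := ltnP j q.
  by have := f0 j.+1 jq; rewrite /cut_coord /= jq.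
by rewrite -(subnKC qj) g0 //; lia.
Qed.

(** The windows cover the sum of the X^(p rho) h rho, which yields the last n + 1 coordinates [g].
    The rows then force the coordinate at the cut p i to be the partial sum [Phi i] divided by X^(p
    i). *)
Lemma zigzag_full N (h : nat -> {poly F}) :
    c 0%N = 0%N -> (forall l, (l < n)%N -> (c l.+1 <= c l + N)%N) ->
    c n = p q.+1 ->
    (forall rho, (rho <= q)%N -> (size (h rho) <= N + (p rho.+1 - p rho))%N) ->
  exists y : nat -> {poly F}, (forall j, (size (y j) <= N)%N) /\
    forall rho, (rho <= q)%N ->
      \sum_(j < q + n.+1) y j * zigzag rho j = h rho.
Proof.
move=> c0 gap cn sh.
have p_mono i j : (i <= j)%N -> (p i <= p j)%N.
  exact: (@homo_leq _ p leq leqnn (fun a b c => @leq_trans a b c) p_nd).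
have sXM a b (u : {poly F}) : (size u <= b)%N -> (size ('X^a * u)%R <= a + b)%N.
  have [->|u0] := eqVneq u 0; first by rewrite mulr0 size_poly0.
  by rewrite mulrC size_mulXn // leq_add2l.
have sXh rho : (rho <= q)%N -> (size ('X^(p rho) * h rho)%R <= p rho.+1 + N)%N.
  move=> rq; apply: leq_trans (sXM _ _ _ (sh _ rq)) _.
  by rewrite addnCA subnKC // addnC.
have [|g [sg HE]] := @window_cover F n c N
    (\sum_(rho < q.+1) 'X^(p rho) * h rho) c0 gap.
  rewrite cn; apply: leq_trans (size_sum _ _ _) _; apply/bigmax_leqP => rho _.
  rewrite (leq_trans (sXh _ (ltn_ord rho : (rho <= q)%N))) // leq_add2r.
  exact: p_mono.
pose phi rho := 'X^(p rho) * h rho -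
  \sum_(l < n.+1 | tau l == rho) 'X^(c l) * g l.
pose Phi i := \sum_(rho < i) phi rho.
have Phiq : Phi q.+1 = 0.
  rewrite /Phi sumrB HE (exchange_big_dep xpredT) //=.
  apply/eqP; rewrite subr_eq0; apply/eqP/eq_bigr => l _.
  by rewrite (big_pred1 (Ordinal (tau_lt (ltn_ord l) : (tau l < q.+1)%N))).
have sPhi i : (i <= q.+1)%N -> (size (Phi i) <= p i + N)%N.
  move=> iq; apply: leq_trans (size_sum _ _ _) _; apply/bigmax_leqP => rho _.
  have rq : (rho <= q)%N by have := ltn_ord rho; lia.
  rewrite (leq_trans (size_polyD _ _)) // size_polyN geq_max; apply/andP; split.
    by rewrite (leq_trans (sXh _ rq)) // leq_add2r p_mono.
  apply: leq_trans (size_sum _ _ _) _; apply/bigmax_leqP => l /eqP tl.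
  rewrite (leq_trans (sXM _ _ _ (sg l))) // leq_add2r.
  have /andP[_ le] := p_tau (ltn_ord l : (l <= n)%N).
  by rewrite (leq_trans le) // tl p_mono.
(* Divisibility by X^(p i): the full sum [Phi q.+1] is 0, so [Phi i] is minus the sum of the
   remaining [phi rho], and these contain only monomials of degree at least p i. *)
have Phi_drop i : (i <= q.+1)%N -> Phi i = 'X^(p i) * drop_poly (p i) (Phi i).
  move=> iq; rewrite -[LHS](poly_take_drop (p i)) mulrC.
  suff -> : take_poly (p i) (Phi i) = 0 by rewrite add0r.
  have -> : Phi i = - \sum_(i <= rho < q.+1) phi rho.
    have : Phi q.+1 = Phi i + \sum_(i <= rho < q.+1) phi rho.
      by rewrite /Phi -!(big_mkord xpredT phi) (big_cat_nat (n := i)).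
    by rewrite Phiq => /esym/eqP; rewrite addr_eq0 => /eqP.
  apply/polyP => z; rewrite coef_take_poly coef0; case: ltnP => // zp.
  rewrite coefN coef_sum big_nat_cond big1 ?oppr0 // => rho.
  rewrite andbT => /andP[ir _].
  have lep : (z < p rho)%N by apply: leq_trans zp (p_mono _ _ ir).
  rewrite coefB coefXnM lep coef_sum big1 ?subr0 // => l /eqP tl.
  have /andP[le _] := p_tau (ltn_ord l : (l <= n)%N).
  by rewrite coefXnM (leq_trans lep) // -tl.
pose y j := if (j < q)%N then drop_poly (p j.+1) (Phi j.+1) else g (j - q)%N.
exists y; split=> [j|rho rq].
  rewrite /y; case: ltnP => // jq.
  by rewrite size_drop_poly leq_subLR sPhi // ltnW.
have fE i : (i <= q.+1)%N ->
    'X^(p i) * cut_coord y i = Phi i.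
  case: i => [|i] iq; rewrite /cut_coord /=.
    by rewrite mulr0 /Phi big_ord0.
  rewrite /y; case: ltnP => [_|qi]; first by rewrite -Phi_drop.
  by rewrite mulr0 (_ : i = q) ?Phiq //; lia.
have X0 : 'X^(p rho) != 0 :> {poly F} by rewrite expf_eq0 polyX_eq0 andbF.
apply: (mulfI X0); rewrite zigzag_row // !fE ?(leqW rq) //.
rewrite {1}/Phi big_ord_recr /= -/(Phi rho) [X in X + _]addrAC subrr add0r /phi.
rewrite [X in _ + X](eq_bigr (fun l : 'I_n.+1 => 'X^(c l) * g l)) ?subrK //.
by move=> l _; rewrite /y ltnNge leq_addr /= addKn.
Qed.

End Zigzag.

Lemma interval_ex (p : nat -> nat) q x : p 0%N = 0%N -> (x <= p q.+1)%N ->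
  exists i, (i <= q)%N && (p i <= x <= p i.+1)%N.
Proof.
move=> p0; elim: q => [|q IH] xp; first by exists 0%N; rewrite p0 xp.
have [/IH[i /andP[iq xi]]|lt] := leqP x (p q.+1).
  by exists i; rewrite xi andbT ltnW.
by exists q.+1; rewrite leqnn xp ltnW.
Qed.

(** The cuts p i = floor(i d / 2) bound intervals of length k and k + 1 alternately, which supply
    the rows of [U] and of [V]. The cuts c l = floor(l r d / n) are evenly spread up to r d = p (2
    r), with gaps beta or beta + 1: windows of length beta are disjoint and windows of length beta +
    1 cover. The number of columns is (2 r - 1) + (n + 1) = m. *)
Lemma synmx_generic_ex (F : fieldType) m r k : (0 < r)%N -> (2 * r < m)%N ->
  let beta := ((r * k.*2.+1) %/ (m - 2 * r))%N in
  exists U V : 'M[{poly F}]_(r, m), [/\ mxsize_le k.+1 U, mxsize_le k.+2 V,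
    row_free (synmx k beta U V) & row_full (synmx k beta.+1 U V)].
Proof.
move=> r0 rm beta; set d := k.*2.+1; set n := (m - 2 * r)%N.
pose q := (2 * r).-1.
have n0 : (0 < n)%N by rewrite subn_gt0.
have q1 : q.+1 = (2 * r)%N by rewrite prednK // muln_gt0.
have qn : (q + n.+1 = m)%N by rewrite addnS -addSn q1 subnKC // ltnW.
pose p i := (i * d)./2; pose c l := ((l * (r * d)) %/ n)%N.
have p0 : p 0%N = 0%N by [].
have pe i : p (2 * i)%N = (i * d)%N by rewrite /p -mulnA mul2n doubleK.
have po i : p (2 * i).+1 = (i * d + k)%N.
  by rewrite /p mulSn -mulnA mul2n halfD doubleK odd_double andbF /= add0n
     /d /= uphalf_double addnC.
have p_nd i : (p i <= p i.+1)%N by rewrite /p half_leq // leq_mul2r leqnSn orbT.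
have cn : c n = p q.+1 by rewrite q1 pe /c mulKn.
have c_le l : (l <= n)%N -> (c l <= p q.+1)%N.
  by move=> ln; rewrite -cn leq_div2r // leq_mul2r ln orbT.
have /choice[tau tauP] : forall l, exists i,
    (l <= n)%N -> (i <= q)%N && (p i <= c l <= p i.+1)%N.
  move=> l; have [ln|nl] := leqP l n; last by exists 0%N.
  by have [i ile] := interval_ex p0 (c_le _ ln); exists i.
have tau_lt l : (l <= n)%N -> (tau l <= q)%N by move=> /tauP/andP[].
have p_tau l : (l <= n)%N -> (p (tau l) <= c l <= p (tau l).+1)%N.
  by move=> /tauP/andP[].
have c_gap1 l : (c l + beta <= c l.+1)%N.
  by rewrite /c mulSn [(_ + l * _)%N]addnC divnD // leq_addr.
have c_gap2 l : (c l.+1 <= c l + beta.+1)%N.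
  by rewrite /c mulSn addnC addnS -addn1 leq_divDl.
pose M := zigzag F q p c tau.
pose U := \matrix_(i < r, j < m) M (2 * i)%N j.
pose V := \matrix_(i < r, j < m) M (2 * i).+1 j.
have jqn (j : 'I_m) : (j <= q + n)%N by rewrite -ltnS -addnS qn.
have s_even i : (p (2 * i).+1 - p (2 * i) = k)%N by rewrite pe po addKn.
have s_odd i : (p (2 * i).+2 - p (2 * i).+1 = k.+1)%N.
  have -> : ((2 * i).+2 = 2 * i.+1)%N by rewrite mulnS.
  by rewrite pe po mulSn [(d + _)%N]addnC subnDl /d -addnn -addnS addKn.
(* The zigzag lemmas index coordinates by natural numbers; those outside the range are 0. *)
pose yn (y : 'rV[{poly F}]_m) j := oapp (y 0) 0 (insub j).
have ynE (y : 'rV_m) (j : 'I_m) : yn y j = y 0 j by rewrite /yn valK.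
have mulM (y : 'rV[{poly F}]_m) rho :
    \sum_(j < m) y 0 j * M rho j = \sum_(j < q + n.+1) yn y j * M rho j.
  by rewrite qn; apply: eq_bigr => j _; rewrite ynE.
have mulU (y : 'rV[{poly F}]_m) i :
    (y *m U^T) 0 i = \sum_(j < q + n.+1) yn y j * M (2 * i)%N j.
  by rewrite -mulM mxE; apply: eq_bigr => j _; rewrite !mxE.
have mulV (y : 'rV[{poly F}]_m) i :
    (y *m V^T) 0 i = \sum_(j < q + n.+1) yn y j * M (2 * i).+1 j.
  by rewrite -mulM mxE; apply: eq_bigr => j _; rewrite !mxE.
have sU : mxsize_le k.+1 U.
  by move=> i j; rewrite mxE -(s_even i); apply: size_zigzag p_tau _ _ _.
have sV : mxsize_le k.+2 V.
  by move=> i j; rewrite mxE -(s_odd i); apply: size_zigzag p_tau _ _ _.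
have rows (P : nat -> Prop) : (forall i : 'I_r, P (2 * i)%N) ->
    (forall i : 'I_r, P (2 * i).+1) -> forall rho, (rho <= q)%N -> P rho.
  move=> Pe Po rho rq; have ir : (rho./2 < r)%N by lia.
  rewrite -[rho]odd_double_half -mul2n.
  by case: (odd rho); [exact: (Po (Ordinal ir))|exact: (Pe (Ordinal ir))].
exists U, V; split=> //.
  apply/(synmx_free sU sV) => y sy yU yV; apply/rowP => j; rewrite mxE -ynE.
  apply: (@zigzag_free F q n p c tau p0 p_nd tau_lt p_tau beta (yn y)
    (fun l _ => c_gap1 l)).
  - by move=> l; rewrite /yn; case: insubP => [u _ _|_] /=; rewrite ?size_poly0.
  - apply: rows => i; first by rewrite -mulU yU mxE.
    by rewrite -mulV yV mxE.
  - by rewrite qn.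
apply/(synmx_full sU sV) => h1 h2 s1 s2.
pose h rho := if odd rho then oapp (h2 0) 0 (insub rho./2)
              else oapp (h1 0) 0 (insub rho./2).
have he (i : 'I_r) : h (2 * i)%N = h1 0 i.
  by rewrite /h mul2n odd_double doubleK valK.
have ho (i : 'I_r) : h (2 * i).+1 = h2 0 i.
  by rewrite /h mul2n /= odd_double /= uphalf_double valK.
have [||y [sy yh]] := @zigzag_full F q n p c tau p0 p_nd tau_lt p_tau
    beta.+1 h _ (fun l _ => c_gap2 l) cn.
- by rewrite /c mul0n div0n.
- by apply: rows => i; rewrite ?he ?ho ?s_even ?s_odd.
exists (\row_j y j).
have yrow rho : \sum_(j < q + n.+1) yn (\row_j y j) j * M rho j
    = \sum_(j < q + n.+1) y j * M rho j.
  by rewrite qn; apply: eq_bigr => j _; rewrite ynE mxE.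
split; first by move=> i j; rewrite mxE.
- by apply/rowP => i; rewrite mulU yrow yh ?he //; have := ltn_ord i; lia.
- by apply/rowP => i; rewrite mulV yrow yh ?ho //; have := ltn_ord i; lia.
Qed.

(** * Smith form and reversal of wedge products *)

Section WedgeSmith.
Variables (F : fieldType) (r m : nat).
Implicit Types U V : 'M[{poly F}]_(r, m).

Definition symp (A : nzRingType) q : 'M[A]_(q + q) :=
  block_mx 0 1%:M (- 1%:M) 0.

Lemma wedge_symp U V :
  wedge U V = (col_mx U V)^T *m symp _ r *m col_mx U V.
Proof.
rewrite tr_col_mx /symp mul_row_block !mulmx0 mulmxN !mulmx1 addr0 add0r.
by rewrite mul_row_col mulNmx addrC.
Qed.

Lemma symp_unit : symp {poly F} r *m - symp {poly F} r = 1%:M.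
Proof.
rewrite /symp mulmxN mulmx_block !mulmx0 !mul0mx !mulmx1 !mul1mx add0r addr0.
by rewrite addr0 opp_block_mx opprK !oppr0 -scalar_mx_block.
Qed.

(** Column operations [W] bring the stacked factors to (I 0), so the congruence by [W] turns the
    product into the symplectic matrix in the upper left corner, which is invertible over the
    polynomials. *)
Lemma wedge_pid U V Y : col_mx U V *m Y = 1%:M ->
  (r + r <= m)%N /\ exists A B, [/\ A \in unitmx, B \in unitmx &
    A *m wedge U V *m B = pid_mx (r + r)].
Proof.
move=> MY; have [qm [W Wu MW]] := right_invertible_pid MY; split=> //.
set q := (r + r)%N in MW qm *.
pose J := symp {poly F} r; pose iJ := - J.
have JiJ : J *m iJ = 1%:M := symp_unit.
have iJJ : iJ *m J = 1%:M by rewrite mulNmx -mulmxN.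
(* [E X] is the m x m matrix with upper left block [X]; adding [copid_mx q] completes it with an
   identity block. *)
pose E (X : 'M[_]_q) : 'M[{poly F}]_m := pid_mx q *m X *m pid_mx q.
have EE X Y' : E X *m E Y' = E (X *m Y').
  rewrite /E !mulmxA -[_ *m pid_mx q *m pid_mx q]mulmxA mul_pid_mx.
  by rewrite minnn (minn_idPr qm) pid_mx_1 mulmx1.
have E1 : E 1%:M = pid_mx q.
  by rewrite /E mulmx1 mul_pid_mx !minnn.
have EC X : E X *m copid_mx q = 0.
  by rewrite /E -mulmxA mul_pid_mx_copid // mulmx0.
have CE X : copid_mx q *m E X = 0.
  by rewrite /E !mulmxA mul_copid_mx_pid // !mul0mx.
have CC : copid_mx q *m copid_mx q = copid_mx q :> 'M[{poly F}]_m.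
  exact: copid_mx_id.
have inv X Y' : X *m Y' = 1%:M ->
    (E X + copid_mx q) *m (E Y' + copid_mx q) = 1%:M.
  move=> XY; rewrite mulmxDl [E X *m _]mulmxDr [copid_mx q *m _]mulmxDr.
  rewrite EE XY E1 EC CE CC addr0 add0r.
  by rewrite /copid_mx addrC subrK.
exists ((E iJ + copid_mx q) *m W^T), W; split=> //.
  rewrite unitmx_mul unitmx_tr Wu andbT.
  by have /mulmx1_unit[] := inv _ _ iJJ.
have -> : (E iJ + copid_mx q) *m W^T *m wedge U V *m W =
    (E iJ + copid_mx q) *m (W^T *m wedge U V *m W) by rewrite !mulmxA.
rewrite wedge_symp -/J.
have -> : W^T *m ((col_mx U V)^T *m J *m col_mx U V) *m W = E J.
  by rewrite !mulmxA -trmx_mul MW tr_pid_mx -mulmxA MW.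
by rewrite mulmxDl EE iJJ E1 CE addr0.
Qed.

End WedgeSmith.

Section SyndromeConsequences.
Variables (F : fieldType) (r m k : nat) (U V : 'M[{poly F}]_(r, m)).
Hypotheses (sU : mxsize_le k.+1 U) (sV : mxsize_le k.+2 V).

(** The columns of [Y] are preimages of the constant unit vectors, which satisfy the size bounds of
    both components. *)
Lemma synmx_full_right_inv N : row_full (synmx k N.+1 U V) ->
  exists Y, col_mx U V *m Y = 1%:M.
Proof.
move/(synmx_full sU sV) => sur.
have /fin_all_exists[y yP] (i : 'I_(r + r)) : exists y : 'rV_m,
    y *m (col_mx U V)^T = row i 1%:M.
  have s1 : mxsize_le 1 (row i (1%:M : 'M[{poly F}]_(r + r))).
    move=> a b; rewrite !mxE.
    by case: (_ == _); rewrite ?size_poly1 ?size_poly0.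
  have [||y [_ yU yV]] := sur (lsubmx (row i 1%:M)) (rsubmx (row i 1%:M)).
  - by move=> a b; rewrite mxE (leq_trans (s1 _ _)).
  - by move=> a b; rewrite mxE (leq_trans (s1 _ _)).
  by exists y; rewrite tr_col_mx mul_mx_row yU yV hsubmxK.
exists (\matrix_i y i)^T.
apply: trmx_inj; rewrite trmx_mul trmxK trmx1; apply/row_matrixP => i.
by rewrite row_mul rowK yP.
Qed.

(** A right-hand side of the next size is a constant plus X times one of the previous size, and
    preimages combine in the same way. *)
Lemma synmx_fullS N :
  row_full (synmx k N.+1 U V) -> row_full (synmx k N.+2 U V).
Proof.
move/(synmx_full sU sV) => sur; apply/(synmx_full sU sV) => h1 h2 s1 s2.
pose tk (h : 'rV[{poly F}]_r) := map_mx (take_poly 1) h.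
pose dr (h : 'rV[{poly F}]_r) := map_mx (drop_poly 1) h.
have tkE h : tk h + 'X *: dr h = h.
  by apply/rowP => j; rewrite !mxE mulrC -['X]expr1 poly_take_drop.
have stk h M : mxsize_le M.+1 (tk h).
  by move=> i j; rewrite mxE (leq_trans (size_take_poly _ _)).
have sdr h M : mxsize_le M.+1 h -> mxsize_le M (dr h).
  by move=> sh i j; rewrite mxE size_drop_poly leq_subLR add1n.
have [||y1 [sy1 y1U y1V]] := sur (tk h1) (tk h2); [exact: stk| |].
  by rewrite addSn; exact: stk.
have [||y2 [sy2 y2U y2V]] := sur (dr h1) (dr h2); [exact: sdr|exact: sdr|].
exists (y1 + 'X *: y2); split.
- move=> i j; rewrite !mxE (leq_trans (size_polyD _ _)) // geq_max.
  rewrite (leq_trans (sy1 _ _)) //=.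
  have [->|y20] := eqVneq (y2 i j) 0; first by rewrite mulr0 size_poly0.
  by rewrite mulrC size_mulX // ltnS.
- by rewrite mulmxDl -scalemxAl y1U y2U tkE.
- by rewrite mulmxDl -scalemxAl y1V y2V tkE.
Qed.

End SyndromeConsequences.

(** * Reversal, which exchanges 0 and infinity *)

Section Reversal.
Variable F : fieldType.

Definition revp d (p : {poly F}) : {poly F} := \poly_(i < d.+1) p`_(d - i).

Lemma revp_is_linear d : linear (revp d).
Proof.
move=> c p q; apply/polyP => i; rewrite coefD coefZ !coef_poly coefD coefZ.
by case: ifP; rewrite ?mulr0 ?addr0.
Qed.

HB.instance Definition _ d := GRing.isLinear.Build F {poly F} {poly F} _
  (revp d) (revp_is_linear d).

Lemma size_revp d (p : {poly F}) : (size (revp d p) <= d.+1)%N.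
Proof. exact: size_poly. Qed.

Lemma revp_Xn d i : (i <= d)%N -> revp d 'X^i = 'X^(d - i).
Proof.
move=> id; apply/polyP => j; rewrite coef_poly !coefXn.
case: ltnP => jd; last by rewrite [RHS]mulrb ifF //; lia.
by congr (_%:R); congr nat_of_bool; lia.
Qed.

Lemma revpK d (p : {poly F}) : (size p <= d.+1)%N -> revp d (revp d p) = p.
Proof.
move=> sp; apply/polyP => i; rewrite !coef_poly.
case: ltnP => id; last by rewrite nth_default // (leq_trans sp).
by rewrite ltnS leq_subr subKn.
Qed.

Lemma revp_mul a b (p q : {poly F}) :
  (size p <= a.+1)%N -> (size q <= b.+1)%N ->
  revp (a + b) (p * q)%R = revp a p * revp b q.
Proof.
have expand c (u : {poly F}) : (size u <= c.+1)%N ->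
    u = \sum_(i < c.+1) u`_i *: 'X^i.
  move=> su; rewrite -poly_def; apply/polyP => i; rewrite coef_poly.
  by case: ltnP => // /(leq_trans su)/(nth_default _) ->.
have revE c (u : {poly F}) : (size u <= c.+1)%N ->
    revp c u = \sum_(i < c.+1) u`_i *: 'X^(c - i).
  move=> su; rewrite {1}(expand _ _ su) linear_sum; apply: eq_bigr => i _.
  by rewrite linearZ /= revp_Xn // -ltnS.
move=> sp sq; rewrite (revE _ _ sp) (revE _ _ sq).
rewrite {1}(expand _ _ sp) {1}(expand _ _ sq) mulr_suml linear_sum mulr_suml.
apply: eq_bigr => i _; rewrite !mulr_sumr linear_sum; apply: eq_bigr => j _.
rewrite -!scalerAl -!scalerAr !linearZ /= -!exprD revp_Xn; last first.
  by rewrite leq_add // -ltnS.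
rewrite [RHS]scalerA mulrC -scalerA; congr (_ *: (_ *: 'X^_));
  by have := ltn_ord i; have := ltn_ord j; lia.
Qed.

Section Matrices.
Variables (r m k : nat) (U V : 'M[{poly F}]_(r, m)).
Hypotheses (sU : mxsize_le k.+1 U) (sV : mxsize_le k.+2 V).

Lemma wedge_rev :
  map_mx (revp k.*2.+1) (wedge U V) =
  wedge (map_mx (revp k) U) (map_mx (revp k.+1) V).
Proof.
apply/matrixP => i j; rewrite mxE !wedgeE linear_sum; apply: eq_bigr => l _.
rewrite linearB /= !mxE (_ : k.*2.+1 = (k + k.+1)%N); last by lia.
rewrite [V l i * _]mulrC !revp_mul ?sU ?sV //.
by congr (_ - _); rewrite mulrC.
Qed.

(** Reversal is multiplicative when grades add, and it is an involution at a fixed grade. So a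
    preimage for the reversed factors is the reversal, at grade N, of a preimage of the reversed
    right-hand side. *)
Lemma synmx_full_rev N : row_full (synmx k N.+1 U V) ->
  row_full (synmx k N.+1 (map_mx (revp k) U) (map_mx (revp k.+1) V)).
Proof.
move/(synmx_full sU sV) => sur.
have sU' : mxsize_le k.+1 (map_mx (revp k) U).
  by move=> i j; rewrite mxE size_revp.
have sV' : mxsize_le k.+2 (map_mx (revp k.+1) V).
  by move=> i j; rewrite mxE size_revp.
apply/(synmx_full sU' sV') => h1 h2 s1 s2.
have [||y [sy yU yV]] := sur (map_mx (revp (N + k)) h1)
    (map_mx (revp (N + k.+1)) h2).
- by move=> i j; rewrite mxE size_revp.
- by move=> i j; rewrite mxE size_revp.
have mul_rev l (M : 'M[{poly F}]_(r, m)) : mxsize_le l.+1 M ->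
    map_mx (revp N) y *m (map_mx (revp l) M)^T =
    map_mx (revp (N + l)) (y *m M^T).
  move=> sM; apply/rowP => j; rewrite !mxE linear_sum; apply: eq_bigr => i _.
  by rewrite !mxE /= revp_mul ?sM ?sy.
exists (map_mx (revp N) y); split.
- by move=> i j; rewrite mxE size_revp.
- by rewrite mul_rev // yU; apply/rowP => j; rewrite !mxE revpK.
- by rewrite mul_rev // yV; apply/rowP => j; rewrite !mxE revpK.
Qed.

End Matrices.
End Reversal.

(** * Elementary divisors *)

Lemma rank_map_equiv (F K : fieldType) (f : {rmorphism {poly F} -> K}) m
    (A B P : 'M[{poly F}]_m) : A \in unitmx -> B \in unitmx ->
  \rank (map_mx f (A *m P *m B)) = \rank (map_mx f P).
Proof.
have fu (X : 'M[_]_m) : X \in unitmx -> map_mx f X \in unitmx.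
  by rewrite !unitmxE det_map_mx; exact: rmorph_unit.
move=> /fu Au /fu Bu; rewrite !map_mxM mxrankMfree ?row_free_unit //.
by rewrite eqmxMfull // row_full_unit.
Qed.

Section ElementaryDivisors.
Variable R : realType.
Local Notation C := R[i].
Variables (m q : nat) (P A B : 'M[{poly C}]_m).
Hypotheses (qm : (q <= m)%N) (Au : A \in unitmx) (Bu : B \in unitmx).
Hypothesis APB : A *m P *m B = pid_mx q.

(** Used for the embedding into the fractions and for evaluations: the rank drops at no point. *)
Lemma rank_map_pid (K : fieldType) (f : {rmorphism {poly C} -> K}) :
  \rank (map_mx f P) = q.
Proof. by rewrite -(rank_map_equiv f P Au Bu) APB map_pid_mx rank_pid_mx. Qed.

Let D (s : seq {poly C}) : 'M[_]_m := \matrix_(i, j) (s`_i *+ (i == j)).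

(** If the entry of index i0 vanished at alpha, so would all later ones by divisibility, and the
    rank at alpha would be at most i0 < [size s]. But the rank over the fractions is [size s], and
    both ranks are q. *)
Lemma invariant_polynomials_root s alpha : invariant_polynomials P s ->
  {in s, forall p, ~~ root p alpha}.
Proof.
case=> monic_s sm sorted_s [U [V [Uu Vu UPV]]] p ps; apply/negP => pa.
have rD (K : fieldType) (f : {rmorphism {poly C} -> K}) :
    \rank (map_mx f (D s)) = q.
  by rewrite /D -UPV rank_map_equiv // rank_map_pid.
pose i0 := index p s.
have i0s : (i0 < size s)%N by rewrite index_mem.
have sa (i : nat) : (i0 <= i)%N -> (s`_i).[alpha] = 0.
  move=> i0i; have [si|si] := leqP (size s) i.
    by rewrite nth_default // horner0.
  have /dvdpP[c ->] : p %| s`_i.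
    rewrite -{1}(nth_index 0 ps).
    exact: (sorted_leq_nth (@dvdp_trans C) (@dvdpp C) 0 sorted_s).
  by rewrite hornerM (rootP pa) mulr0.
have le1 : (q <= i0)%N.
  rewrite -(rD _ (horner_eval alpha)).
  have -> : map_mx (horner_eval alpha) (D s) =
      pid_mx i0 *m map_mx (horner_eval alpha) (D s).
    apply/matrixP => i j; rewrite [RHS]mxE (bigD1 i) //= big1 => [|k ki].
      rewrite !mxE eqxx /= addr0; case: ltnP => ii0; rewrite ?mul1r //.
      by rewrite mul0r raddfMn /= /horner_eval sa ?mul0rn.
    by rewrite !mxE [(i : nat) == k]eq_sym val_eqE (negPf ki) mul0r.
  rewrite (leq_trans (mxrankM_maxl _ _)) // rank_pid_mx //;
    exact: leq_trans (ltnW i0s) sm.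
have le2 : (size s <= q)%N.
  rewrite -(rD _ (@tofrac {poly C})).
  have -> : size s = \rank (map_mx (@tofrac {poly C}) (D s) *m
      diag_mx (\row_i if (i < size s)%N then (tofrac s`_i)^-1 else 0)).
    rewrite -[LHS](@rank_pid_mx {fraction {poly C}} m m) //; congr (\rank _).
    apply/matrixP => i j; rewrite mul_mx_diag !mxE.
    have [->|ij] := eqVneq i j; last first.
      by rewrite val_eqE (negPf ij) /= mulr0n rmorph0 mul0r.
    rewrite eqxx mulr1n; case: ltnP => js; last by rewrite mulr0.
    rewrite divff // tofrac_eq0 monic_neq0 // monic_s //; exact: mem_nth.
  exact: mxrankM_maxl.
by have := leq_trans i0s (leq_trans le2 le1); rewrite ltnn.
Qed.

Lemma elementary_divisors_nil alpha e :
  elementary_divisors P alpha e <-> e = [::].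
Proof.
split=> [[s inv]|->].
  have nr := invariant_polynomials_root alpha inv.
  rewrite (_ : [seq delta <- _ | _] = [::]) => [/perm_nilP //|].
  apply/eqP; rewrite -size_eq0 size_filter -leqn0 leqNgt -has_count.
  by apply/hasPn => _ /mapP[p ps ->]; rewrite mupNroot ?nr.
exists (nseq q 1).
  split; rewrite ?size_nseq //.
  - by move=> p; rewrite mem_nseq => /andP[_ /eqP ->]; exact: monic1.
  - by case: (q) => //= l; elim: l => //= l ->; rewrite dvdpp.
  exists A, B; split=> //; rewrite APB; apply/matrixP => i j.
  by rewrite !mxE nth_nseq -val_eqE andbC; case: ifP => _; rewrite ?mul0rn.
rewrite (_ : [seq delta <- _ | _] = [::]) //.
apply/eqP; rewrite -size_eq0 size_filter -leqn0 leqNgt -has_count.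
apply/hasPn => _ /mapP[p + ->]; rewrite mem_nseq => /andP[_ /eqP ->].
by rewrite mupNroot // root1.
Qed.

End ElementaryDivisors.

(** * Minimal indices *)

Section KernelEvaluation.
Variables (F : fieldType) (r m k : nat) (U V : 'M[{poly F}]_(r, m)).
Hypotheses (sU : mxsize_le k.+1 U) (sV : mxsize_le k.+2 V).

Local Notation ev0 := (map_mx (fun p : {poly F} => p`_0)).
Local Notation S N := (synmx k N U V).

Definition ev0mx N : 'M[F]_(m * N, m) := ev0 (decm (1%:M : 'M[_]_(m * N))).

Lemma mul_ev0mx q N (A : 'M[_]_(q, m * N)) : A *m ev0mx N = ev0 (decm A).
Proof.
rewrite -[in RHS](mulmx1 A) decmM; apply/matrixP => i j; rewrite !mxE coef_sum.
by apply: eq_bigr => l _; rewrite !mxE coefCM.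
Qed.

(** A null vector of size N + 1 that vanishes at 0 is X times a null vector of size N; [sh] is the
    matrix of multiplication by X. *)
Lemma rank_ker_ev0 N :
  (\rank (kermx (S N.+1) :&: kermx (ev0mx N.+1)) <= \rank (kermx (S N)))%N.
Proof.
pose sh : 'M[F]_(m * N, m * N.+1) :=
  encm N.+1 ('X *: decm (1%:M : 'M[F]_(m * N))).
have shE (v : 'rV_(m * N)) : v *m sh = encm N.+1 ('X *: decm v).
  by rewrite -encmM -[in RHS](mulmx1 v) decmM scalemxAr.
apply: (@leq_trans (\rank (kermx (S N) *m sh))); last exact: mxrankM_maxl.
apply: mxrankS; apply/rV_subP => w; rewrite sub_capmx => /andP[/sub_kermxP wS].
move=> /sub_kermxP; rewrite mul_ev0mx => w0.
have [wU wV] := (synmx_eq0 sU sV w).1 wS.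
pose y : 'rV_m := map_mx (drop_poly 1) (decm w).
have wE : decm w = 'X *: y.
  apply/rowP => j; rewrite [RHS]mxE [y 0 j]mxE.
  have w0j : (decm w 0 j)`_0 = 0 by move/rowP: w0 => /(_ j); rewrite !mxE.
  rewrite -[LHS](poly_take_drop 1) expr1 mulrC.
  suff -> : take_poly 1 (decm w 0 j) = 0 by rewrite add0r.
  by apply/polyP => -[|i]; rewrite coef_take_poly coef0.
have Xinj (Z : 'rV[{poly F}]_r) : 'X *: Z = 0 -> Z = 0.
  move=> /rowP XZ; apply/rowP => j; have /eqP := XZ j.
  by rewrite !mxE mulf_eq0 polyX_eq0 => /eqP.
have sy : mxsize_le N y.
  by move=> i j; rewrite mxE size_drop_poly leq_subLR add1n size_decm.
have yS : encm N y *m S N = 0.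
  apply/(synmx_eq0 sU sV); rewrite encmK //.
  by split; apply: Xinj; rewrite scalemxAl -wE.
have /sub_kermxP/submxP[D yD] := yS.
apply/submxP; exists D; rewrite mulmxA -yD shE encmK // -wE.
by rewrite decmK.
Qed.

Lemma rank_ker_synmx N : row_full (S N) ->
  \rank (kermx (S N)) = (m * N - (r * (N + k) + r * (N + k.+1)))%N.
Proof. by move=> /eqP full; rewrite mxrank_ker full. Qed.

(* Evaluation at 0 is injective on the null vectors of size N + 1, which
   have size at least N + 1, and it loses at most the multiples of X among the
   null vectors of size N + 2.  Hence null vectors whose values at 0 form a
   basis of the second image extending a basis of the first. *)
Lemma null_basis N n : row_free (S N) -> row_full (S N.+1) ->
    (\rank (kermx (S N.+1)) + n <= \rank (kermx (S N.+2)))%N ->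
  exists q1 q2 (B1 : 'M[{poly F}]_(q1, m)) (B2 : 'M[_]_(q2, m)),
    [/\ q1 = \rank (kermx (S N.+1)), (n <= q1 + q2)%N,
        mxsize_le N.+1 B1 /\ mxsize_le N.+2 B2,
        col_mx B1 B2 *m U^T = 0 /\ col_mx B1 B2 *m V^T = 0 &
        row_free (ev0 (col_mx B1 B2))].
Proof.
move=> fr full rk; pose K1 := kermx (S N.+1); pose K2 := kermx (S N.+2).
pose Z1 := K1 *m ev0mx N.+1; pose Z2 := K2 *m ev0mx N.+2.
have rZ1 : \rank Z1 = \rank K1.
  have := mxrank_mul_ker K1 (ev0mx N.+1); rewrite -/Z1.
  have : (\rank (K1 :&: kermx (ev0mx N.+1)) <= 0)%N.
    rewrite (leq_trans (rank_ker_ev0 N)) // leqn0 mxrank_eq0.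
    by rewrite kermx_eq0.
  by rewrite leqn0 => /eqP ->; rewrite addn0.
have rZ2 : (n <= \rank Z2)%N.
  have := mxrank_mul_ker K2 (ev0mx N.+2); rewrite -/Z2.
  have := rank_ker_ev0 N.+1; rewrite -/K1 -/K2 => h E.
  rewrite -(leq_add2l (\rank K1)) (leq_trans rk) // -/K2 -E addnC.
  by rewrite leq_add2r.
(* A null vector keeps its value at 0 when the size bound is relaxed. *)
have Z12 : (Z1 <= Z2)%MS.
  have sK1 : mxsize_le N.+2 (decm K1).
    by move=> i j; rewrite (leq_trans (size_decm _ _ _)).
  have -> : Z1 = encm N.+2 (decm K1) *m ev0mx N.+2.
    by rewrite /Z1 !mul_ev0mx encmK.
  apply: submxMr; apply/sub_kermxP/(synmx_eq0 sU sV); rewrite encmK //.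
  by apply/(synmx_eq0 sU sV); rewrite mulmx_ker.
have /submxP[D1 D1E] : (row_base Z1 <= Z1)%MS by rewrite eq_row_base.
have /submxP[D2 D2E] : (row_base (Z2 :\: Z1)%MS <= Z2)%MS.
  by rewrite eq_row_base diffmxSl.
have rZ : (\rank Z1 + \rank (Z2 :\: Z1)%MS = \rank Z2)%N.
  by rewrite -(mxrank_cap_compl Z2 Z1) (capmx_idPr Z12).
exists (\rank Z1), (\rank (Z2 :\: Z1)%MS), (decm (D1 *m K1)), (decm (D2 *m K2)).
have [n1U n1V] : decm (D1 *m K1) *m U^T = 0 /\ decm (D1 *m K1) *m V^T = 0.
  by apply/(synmx_eq0 sU sV); rewrite -mulmxA mulmx_ker mulmx0.
have [n2U n2V] : decm (D2 *m K2) *m U^T = 0 /\ decm (D2 *m K2) *m V^T = 0.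
  by apply/(synmx_eq0 sU sV); rewrite -mulmxA mulmx_ker mulmx0.
split; rewrite ?rZ //.
- by split; exact: size_decm.
- by rewrite !mul_col_mx n1U n1V n2U n2V col_mx0.
have -> : ev0 (col_mx (decm (D1 *m K1)) (decm (D2 *m K2))) =
    col_mx (row_base Z1) (row_base (Z2 :\: Z1)%MS).
  by rewrite D1E D2E map_col_mx -!mul_ev0mx !mulmxA.
rewrite /row_free.
rewrite -addsmxE rZ; apply/eqP.
rewrite (adds_eqmx (eq_row_base _) (eq_row_base _)) addsmxC.
by rewrite -(adds_eqmx (eqmx_refl _) (capmx_idPr Z12)) addsmx_diff_cap_eq.
Qed.

End KernelEvaluation.

(** If G is a right inverse of B(0), then det(B G) has the value 1 at 0, so it is a nonzero
    polynomial and invertible as a fraction. *)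
Lemma row_free_ev0 (F : fieldType) p m (B : 'M[{poly F}]_(p, m)) :
  row_free (map_mx (fun u : {poly F} => u`_0) B) ->
  row_free (map_mx (@tofrac {poly F}) B).
Proof.
case/row_freeP => G BG; pose D := B *m map_mx polyC G.
have D0 : \det D != 0.
  apply: contra_eq_neq (det1 F p) => D0; rewrite -BG.
  have <- : map_mx (horner_eval 0) D =
      map_mx (fun u : {poly F} => u`_0) B *m G.
    rewrite map_mxM; congr (_ *m _); apply/matrixP => i j; rewrite !mxE.
      by rewrite -horner_coef0.
    exact: hornerC.
  by rewrite det_map_mx D0 rmorph0 eq_sym oner_neq0.
apply/row_freeP; exists (map_mx (@tofrac _) (map_mx polyC G) *m
  invmx (map_mx (@tofrac _) D)).
rewrite mulmxA -map_mxM mulmxV // unitmxE det_map_mx unitfE.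
by rewrite tofrac_eq0.
Qed.

(** At least t of the degrees exceed beta, which gives the lower bound. If the sum attains it,
    exactly t of them do, each by 1. *)
Lemma balanced_degrees n t beta (delta : 'I_n -> nat) :
    (t <= n)%N -> (forall i, (beta <= delta i)%N) ->
    (#|[pred i | (delta i <= beta)%N]| <= n - t)%N ->
  (n * beta + t <= \sum_i delta i)%N /\
  ((\sum_i delta i <= n * beta + t)%N ->
   perm_eq [seq delta i | i : 'I_n] (nseq t beta.+1 ++ nseq (n - t) beta)).
Proof.
move=> tn ge_beta card_le.
pose big i : bool := (beta < delta i)%N.
have cardB : (#|[pred i | (delta i <= beta)%N]| + #|[pred i | big i]| = n)%N.
  rewrite -[RHS]card_ord -(cardC [pred i | (delta i <= beta)%N]); congr addn.
  by apply: eq_card => i; rewrite !inE /big ltnNge.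
have sumB : (\sum_i (beta + big i) = n * beta + #|[pred i | big i]|)%N.
  rewrite big_split /= sum_nat_const card_ord; congr addn.
  by rewrite -sum1_card [RHS]big_mkcond /=; apply: eq_bigr => i _;
  rewrite inE; case: (big i).
have le_i i : (beta + big i <= delta i)%N.
  by rewrite /big; case: ltnP => h; rewrite ?addn1 ?addn0.
have le_sum : (n * beta + #|[pred i | big i]| <= \sum_i delta i)%N.
  by rewrite -sumB; apply: leq_sum.
have t_le : (t <= #|[pred i | big i]|)%N by lia.
split=> [|sum_le]; first by apply: leq_trans le_sum; rewrite leq_add2l.
have bt : #|[pred i | big i]| = t by lia.
have deltaE i : delta i = (beta + big i)%N.
  have /leqifP := leqif_sum (fun i (_ : true) => leqif_eq (le_i i)).
  rewrite sumB bt; case: ifP => [/forallP/(_ i)/eqP -> //|_]; lia.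
set s := image_mem _ _.
have sz : size s = n by rewrite size_map size_enum_ord.
have cnt : count (pred1 beta.+1) s = t.
  rewrite count_map -sum1_count big_enum_cond -bt -sum1_card.
  apply: eq_bigl => i; rewrite [RHS]inE /= deltaE.
  by case: (big i); rewrite ?addn1 ?addn0 ?eqxx //= ltn_eqF.
have fE : seq.filter (pred1 beta.+1) s = nseq t beta.+1.
  by rewrite -cnt -size_filter; apply/all_pred1P/filter_all.
have fCE : seq.filter (predC (pred1 beta.+1)) s = nseq (n - t) beta.
  have <- : size (seq.filter (predC (pred1 beta.+1)) s) = (n - t)%N.
    by rewrite size_filter -sz -(count_predC (pred1 beta.+1) s) cnt addKn.
  apply/all_pred1P/allP => x; rewrite mem_filter => /andP[+ /mapP[i _ xE]].
  by rewrite xE deltaE /=; case: (big i) => /=; lia.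
by rewrite -fE -fCE perm_sym; apply/permPl/perm_filterC.
Qed.

(** * The null space of a generic product *)

Section MinimalIndices.
Variable R : realType.
Local Notation C := R[i].
Local Notation K := {fraction {poly C}}.
Variables (m r k n t beta : nat) (U V : 'M[{poly C}]_(r, m)).
Hypotheses (sU : mxsize_le k.+1 U) (sV : mxsize_le k.+2 V).
Hypothesis free_beta : row_free (synmx k beta U V).
Hypothesis full_beta : row_full (synmx k beta.+1 U V).
Hypotheses (mE : m = (2 * r + n)%N) (rdE : (r * k.*2.+1 = n * beta + t)%N).
Hypothesis tn : (t <= n)%N.

(** A right inverse of the stacked factors and the inverse of the symplectic matrix cancel from the
    right. *)
Lemma null_mul_wedge p (B : 'M[{poly C}]_(p, m)) :
  B *m wedge U V = 0 <-> B *m U^T = 0 /\ B *m V^T = 0.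
Proof.
have [Y MY] := synmx_full_right_inv sU sV full_beta.
rewrite wedge_symp; split=> [BW|[BU BV]].
  have : B *m (col_mx U V)^T = 0.
    have := congr1 (fun X => X *m Y *m - symp _ r) BW.
    rewrite !mulmxA -[_ *m col_mx U V *m Y]mulmxA MY mulmx1.
    by rewrite -[_ *m symp _ r *m _]mulmxA symp_unit mulmx1 !mul0mx.
  by rewrite tr_col_mx mul_mx_row -[0 in RHS]row_mx0 => /eq_row_mx.
by rewrite !mulmxA tr_col_mx mul_mx_row BU BV row_mx0 !mul0mx.
Qed.

Lemma rank_ratmx_wedge : \rank (ratmx (wedge U V)) = (2 * r)%N.
Proof.
have [Y MY] := synmx_full_right_inv sU sV full_beta.
have [rm [A [B [Au Bu APB]]]] := wedge_pid MY.
rewrite mul2n -addnn; exact: (rank_map_pid rm Au Bu APB (@tofrac {poly C})).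
Qed.

Lemma ker_wedge_ratmx p (B : 'M[{poly C}]_(p, m)) :
  (ratmx B <= kermx (ratmx (wedge U V)))%MS <->
  B *m U^T = 0 /\ B *m V^T = 0.
Proof.
rewrite -null_mul_wedge; split=> [/sub_kermxP|BW].
  rewrite -map_mxM => /matrixP BW; apply/matrixP => i j.
  have := BW i j; rewrite mxE [RHS]mxE => /eqP.
  by rewrite tofrac_eq0 => /eqP ->; rewrite mxE.
by apply/sub_kermxP; rewrite -map_mxM BW map_mx0.
Qed.

Lemma rank_ker_wedge : \rank (kermx (ratmx (wedge U V))) = n.
Proof. by rewrite mxrank_ker rank_ratmx_wedge mE addKn. Qed.

(** By surjectivity the null vectors of size N form a space of dimension m N - r (2 N + 2 k + 1) = n
    N - r d; here N = beta + 1. *)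
Lemma rank_ker_beta : \rank (kermx (synmx k beta.+1 U V)) = (n - t)%N.
Proof. by rewrite rank_ker_synmx // mE; nia. Qed.

Lemma rank_ker_betaS : \rank (kermx (synmx k beta.+2 U V)) = (2 * n - t)%N.
Proof.
rewrite rank_ker_synmx; last exact: synmx_fullS full_beta.
by rewrite mE; nia.
Qed.

Section Basis.
Variables (p : nat) (B : 'M[{poly C}]_(p, m)).
Hypothesis Bfree : row_free (ratmx B).
Hypotheses (BU : B *m U^T = 0) (BV : B *m V^T = 0).

Lemma vdeg_null_ge i : (beta <= vdeg (row i B))%N.
Proof.
rewrite leqNgt; apply/negP => lt.
have sy : mxsize_le beta (row i B).
  move=> a j; rewrite ord1.
  have := leq_bigmax (F := fun j => (size (row i B 0 j)).-1) j.
  by rewrite -/(vdeg (row i B)); move: lt; case: size => //=; lia.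
have r0 : row i B = 0.
  apply: ((synmx_free sU sV beta).1 free_beta) => //;
    by rewrite -row_mul ?BU ?BV row0.
have /eqP := congr1 (fun X => ratmx X) r0.
rewrite /ratmx map_row map_mx0 rowE mulmx_free_eq0 // => /eqP/rowP/(_ i).
by rewrite !mxE !eqxx => /eqP; rewrite oner_eq0.
Qed.

(** The rows of degree at most beta are independent over the constants and lie in the space of null
    vectors of size beta + 1, which has dimension n - t. *)
Lemma card_vdeg_null_le :
  (#|[pred i | (vdeg (row i B) <= beta)%N]| <= n - t)%N.
Proof.
rewrite -rank_ker_beta; set A := [pred i | _].
pose B' := rowsub (fun a : 'I_#|A| => enum_val a) B.
have sB' : mxsize_le beta.+1 B'.
  move=> a j; rewrite mxE; have : enum_val a \in A by exact: enum_valP.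
  rewrite inE /vdeg => /bigmax_leqP/(_ j isT); rewrite mxE.
  by case: size => // l; rewrite ltnS.
have null : encm beta.+1 B' *m synmx k beta.+1 U V = 0.
  apply/(synmx_eq0 sU sV); rewrite encmK // /B' rowsubE -!mulmxA BU BV.
  by rewrite !mulmx0.
suff fr : row_free (encm beta.+1 B').
  rewrite -(eqP fr); apply: mxrankS; exact/sub_kermxP.
apply: inj_row_free => v; rewrite -encmM => vB.
have {}vB : map_mx polyC v *m B' = 0.
  apply: encm_eq0 vB => a j; rewrite mxE.
  apply: leq_trans (size_sum _ _ _) _; apply/bigmax_leqP => l _.
  by rewrite mxE mul_polyC (leq_trans (size_scale_leq _ _)).
have /eqP := congr1 (fun X => ratmx X) vB.
rewrite /ratmx map_mx0 /B' rowsubE mulmxA map_mxM mulmx_free_eq0 // => /eqP.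
move=> /rowP vs; apply/rowP => a.
have /eqP := vs (enum_val a); rewrite !mxE tofrac_eq0 => /eqP.
rewrite (bigD1 a) //= big1 => [|b ba].
  by rewrite !mxE eqxx mulr1 addr0 => /eqP; rewrite polyC_eq0 => /eqP.
by rewrite !mxE (inj_eq enum_val_inj) (negPf ba) mulr0.
Qed.

End Basis.

(** By [balanced_degrees] every polynomial basis has degree sum at least n beta + t, and only the
    stated list of degrees attains it. The basis from [null_basis] does attain it. Any [N] with this
    row space is allowed, which serves both the left and the right null space. *)
Lemma minimal_indices_null l (N : 'M[K]_(l, m)) e :
    (N == kermx (ratmx (wedge U V)))%MS ->
  minimal_indices N e <-> perm_eq e (nseq t beta.+1 ++ nseq (n - t) beta).
Proof.
move=> /eqmxP NE.
have basis p (B : 'M[{poly C}]_(p, m)) : polynomial_basis N B ->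
    [/\ p = n, row_free (ratmx B), B *m U^T = 0 & B *m V^T = 0].
  case/andP=> fr /eqmxP BN; have [BU BV] : B *m U^T = 0 /\ B *m V^T = 0.
    by apply/ker_wedge_ratmx; rewrite BN NE.
  by split=> //; rewrite -(eqP fr) BN NE rank_ker_wedge.
have balanced p (B : 'M[{poly C}]_(p, m)) : polynomial_basis N B ->
    (n * beta + t <= \sum_i vdeg (row i B))%N /\
    ((\sum_i vdeg (row i B) <= n * beta + t)%N ->
     perm_eq [seq vdeg (row i B) | i : 'I_p]
             (nseq t beta.+1 ++ nseq (n - t) beta)).
  case/basis=> pn fr BU BV; rewrite -pn; apply: balanced_degrees.
  - by rewrite pn.
  - by move=> i; exact: vdeg_null_ge.
  - by rewrite [X in (_ <= X - _)%N]pn; exact: card_vdeg_null_le.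
have [|q1 [q2 [B1 [B2 [q1E nq [s1 s2] [BU BV] /row_free_ev0 fr]]]]] :=
    null_basis sU sV (n := n) free_beta full_beta.
  by rewrite rank_ker_beta rank_ker_betaS; lia.
pose B0 := col_mx B1 B2.
have B0basis : polynomial_basis N B0.
  apply/andP; split=> //.
  have sub : (ratmx B0 <= kermx (ratmx (wedge U V)))%MS.
    by apply/ker_wedge_ratmx.
  have eqk : (ratmx B0 == kermx (ratmx (wedge U V)))%MS.
    rewrite -(geq_leqif (mxrank_leqif_eq sub)) rank_ker_wedge.
    by rewrite (eqP (fr : row_free (ratmx B0))).
  by apply/eqmxP; exact: eqmx_trans (eqmxP eqk) (eqmx_sym NE).
have [q12 _ _ _] := basis _ _ B0basis.
have vdeg_le d (v : 'rV[{poly C}]_m) : mxsize_le d.+1 v -> (vdeg v <= d)%N.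
  move=> sv; apply/bigmax_leqP => j _.
  by have := sv 0 j; case: size => // x; rewrite ltnS.
have sum0 : (\sum_i vdeg (row i B0) <= n * beta + t)%N.
  rewrite big_split_ord /=.
  (* There are q1 = n - t rows of degree at most beta and q2 = t rows of degree at most beta + 1. *)
  apply: (@leq_trans (q1 * beta + q2 * beta.+1)); last first.
    by rewrite rank_ker_beta in q1E; nia.
  apply: leq_add; rewrite -[X in (X * _)%N]card_ord -sum_nat_const.
    apply: leq_sum => i _; apply: vdeg_le => a j.
    by rewrite !mxE (unsplitK (inl i)) s1.
  apply: leq_sum => i _; apply: vdeg_le => a j.
  by rewrite !mxE (unsplitK (inr i)) s2.
split=> [[p [B [[Bb Bmin] eB]]]|eP].
  have [pn _ _ _] := basis _ _ Bb.
  apply: perm_trans eB (proj2 (balanced _ _ Bb) _).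
  have pq : p = (q1 + q2)%N by rewrite pn q12.
  clear pn; subst p.
  exact: leq_trans (Bmin _ B0basis) sum0.
exists (q1 + q2)%N, B0; split.
  split=> // B' B'b; apply: leq_trans sum0 _.
  exact: (proj1 (balanced _ _ B'b)).
by rewrite (perm_trans eP) // perm_sym (proj2 (balanced _ _ B0basis)).
Qed.

End MinimalIndices.

(** * Closures *)

Section Topology.
Variable R : realType.
Local Notation C := R[i].

Lemma normr_normc (z : C) : `|z| = (Normc.normc z)%:C%C.
Proof. by rewrite normc_def; case: z. Qed.

Lemma normc_real (s : R) : 0 <= s -> Normc.normc (s%:C)%C = s.
Proof. by move=> s0; rewrite /= expr0n /= addr0 sqrtr_sqr ger0_norm. Qed.

Lemma frobeniusZ m n (s : R) (A : 'M[C]_(m, n)) : 0 <= s ->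
  frobenius ((s%:C)%C *: A) = s * frobenius A.
Proof.
move=> s0; rewrite /frobenius -[X in X * _](ger0_norm s0) -sqrtr_sqr.
rewrite -sqrtrM ?sqr_ge0 //; congr Num.sqrt.
rewrite mulr_sumr; apply: eq_bigr => i _; rewrite mulr_sumr.
by apply: eq_bigr => j _; rewrite mxE Normc.normcM normc_real // exprMn.
Qed.

Lemma le_sqrt_sum (I : finType) (f : I -> R) i :
  0 <= f i -> f i <= Num.sqrt (\sum_j f j ^+ 2).
Proof.
move=> fi; rewrite -[X in X <= _](ger0_norm fi) -sqrtr_sqr ler_wsqrtr //.
by rewrite (bigD1 i) //= lerDl sumr_ge0 // => j _; exact: sqr_ge0.
Qed.

Lemma coef_le_mpdist d m (P Q : POLss R d m) i j l : (l <= d)%N ->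
  Normc.normc ((P i j)`_l - (Q i j)`_l) <= mpdist d P Q.
Proof.
move=> ld; pose Al := mpcoef l P - mpcoef l Q.
have -> : (P i j)`_l - (Q i j)`_l = Al i j by rewrite !mxE.
apply: (@le_trans _ _ (frobenius Al)).
  rewrite /frobenius pair_bigA.
  exact: (@le_sqrt_sum _ (fun p => Normc.normc (Al p.1 p.2)) (i, j)
    (normc_ge0 _)).
exact: (@le_sqrt_sum _ (fun l : 'I_d.+1 => frobenius (mpcoef l P - mpcoef l Q))
  (Ordinal (ld : (l < d.+1)%N)) (frobenius_ge0 _)).
Qed.

Lemma POLssP d m (P : POLss R d m) : mxsize_le d.+1 P /\ P^T = - (P : 'M[_]_m).
Proof.
case: P => P /= /andP[/'forall_forallP sP /forallP skP]; split=> //.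
apply/matrixP => i j; apply/polyP => l; rewrite !mxE.
have [ld|dl] := leqP l d.
  have /eqP/matrixP/(_ i j) := skP (Ordinal (ld : (l < d.+1)%N)).
  by rewrite !mxE coefN.
by rewrite coefN !nth_default ?oppr0 // (leq_trans (sP _ _)).
Qed.

Lemma POLss_ex d m (P : 'M[{poly C}]_m) : mxsize_le d.+1 P -> P^T = - P ->
  exists Q : POLss R d m, POLss_val Q = P.
Proof.
move=> sP skP.
suff h : has_grade d P && [forall i : 'I_d.+1, (mpcoef i P)^T == - mpcoef i P].
  by exists (POLssMk h).
apply/andP; split; first by apply/'forall_forallP.
apply/forallP => l; apply/eqP/matrixP => i j.
have Pji : P j i = - P i j by move/matrixP: skP => /(_ i j); rewrite !mxE.
by rewrite !mxE /= Pji coefN.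
Qed.

Lemma closure_mpdist d m (A : set (POLss R d m)) (P : POLss R d m) :
  closure A P <-> forall e : R, 0 < e -> exists2 Q, A Q & mpdist d P Q < e.
Proof.
split=> [cl e e0|near B /nbhs_ballP[e /= e0 eB]].
  have [Q [AQ]] := cl _ (nbhsx_ballx P e e0).
  by rewrite ballEmdist => PQ; exists Q.
have [Q AQ PQ] := near e e0; exists Q; split=> //; apply: eB.
by rewrite ballEmdist.
Qed.

(** For s < 1 the distance from P to Q is at most s G, where G does not depend on s. *)
Lemma closure_quadratic d m (A : set (POLss R d m)) (P : POLss R d m)
    (E1 E2 : 'M[{poly C}]_m) :
    (forall delta : R, 0 < delta -> exists s : R, 0 < s < delta /\
       exists2 Q, A Q & POLss_val Q = POLss_val P +
         (s%:C)%C%:P *: (E1 + (s%:C)%C%:P *: E2)) ->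
  closure A P.
Proof.
move=> near; apply/closure_mpdist => e e0.
pose g (l : 'I_d.+1) := frobenius (mpcoef l E1) + frobenius (mpcoef l E2).
pose G := Num.sqrt (\sum_l g l ^+ 2).
have G0 : 0 <= G by exact: sqrtr_ge0.
have G1 : 0 < G + 1 by rewrite ltr_wpDl.
(* The 1 absorbs s^2 into s; the denominator [G + 1] stays positive when G = 0. *)
pose delta := Num.min 1 (e / (G + 1)).
have [|s [/andP[s0 sd] [Q AQ QE]]] := near delta.
  by rewrite lt_min ltr01 divr_gt0.
move: sd; rewrite lt_min => /andP[s1 se].
exists Q => //; apply: (@le_lt_trans _ _ (s * G)); last first.
  have : s * (G + 1) < e by rewrite -ltr_pdivlMr.
  by apply: le_lt_trans; rewrite ler_wpM2l ?lerDl // ltW.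
rewrite /mpdist -[X in X * _](ger0_norm (ltW s0)) -sqrtr_sqr.
rewrite -sqrtrM ?sqr_ge0 //.
rewrite ler_wsqrtr // mulr_sumr; apply: ler_sum => l _.
rewrite -exprMn ler_pXn2r ?nnegrE ?frobenius_ge0 //; last first.
  by rewrite mulr_ge0 ?(ltW s0) // addr_ge0 ?frobenius_ge0.
have -> : mpcoef l P - mpcoef l Q =
    - ((s%:C)%C *: (mpcoef l E1 + (s%:C)%C *: mpcoef l E2)).
  apply/matrixP => i j; rewrite QE !mxE /= coefD coefCM coefD coefCM.
  by rewrite opprD addrA subrr add0r.
rewrite frobeniusN frobeniusZ ?(ltW s0) // ler_wpM2l ?(ltW s0) //.
apply: le_trans (frobeniusD _ _) _; rewrite lerD2l frobeniusZ ?(ltW s0) //.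
by rewrite ler_piMl ?frobenius_ge0 // ltW.
Qed.

End Topology.

(** If v Y = 0, then v = v (X - Y) X^-1, so the sum of the |v_j| is at most S / (S + 1) times itself
    and v = 0. *)
Lemma unitmx_near (F : numFieldType) n (X : 'M[F]_n) : X \in unitmx ->
  exists2 e : F, 0 < e & forall Y : 'M[F]_n,
    (forall i j, `|X i j - Y i j| < e) -> Y \in unitmx.
Proof.
move=> Xu; pose S := \sum_i \sum_j `|invmx X i j|.
have S0 : 0 <= S by rewrite sumr_ge0 // => i _; rewrite sumr_ge0.
have S1 : 0 < S + 1 by rewrite ltr_wpDl.
exists (S + 1)^-1; first by rewrite invr_gt0.
move=> Y XY; rewrite -row_free_unit; apply: inj_row_free => v vY.
have vE : v = v *m (X - Y) *m invmx X.
  by rewrite mulmxBr vY subr0 mulmxK.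
pose N := \sum_j `|v 0 j|.
have N0 : 0 <= N by rewrite sumr_ge0.
have : N <= N * ((S + 1)^-1 * S).
  have h l : `|(v *m (X - Y)) 0 l| <= N * (S + 1)^-1.
    rewrite mxE (le_trans (ler_norm_sum _ _ _)) // mulr_suml.
    apply: ler_sum => i _; rewrite normrM ler_wpM2l // !mxE ltW //.
  rewrite {1}/N vE.
  apply: (@le_trans _ _ (\sum_j \sum_l N * (S + 1)^-1 * `|invmx X l j|)).
    apply: ler_sum => j _; rewrite mxE (le_trans (ler_norm_sum _ _ _)) //.
    by apply: ler_sum => l _; rewrite normrM ler_wpM2r.
  rewrite exchange_big mulrA /S mulr_sumr; apply: ler_sum => l _.
  by rewrite mulr_sumr.
have lt1 : (S + 1)^-1 * S < 1 by rewrite mulrC ltr_pdivrMr // mul1r ltrDl.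
move=> NN; have N_0 : N = 0.
  apply/eqP; apply: contraT => Nn.
  have Np : 0 < N by rewrite lt_neqAle eq_sym Nn.
  have lt : N * ((S + 1)^-1 * S) < N by rewrite gtr_pMr.
  by move: NN; rewrite (lt_geF lt).
apply/rowP => j; rewrite mxE; apply/eqP.
rewrite -normr_eq0 eq_le normr_ge0 andbT.
by rewrite -N_0 /N (bigD1 j) //= lerDl sumr_ge0.
Qed.

Lemma full_rank_minor (F : fieldType) m n (A : 'M[F]_(m, n)) :
  exists (f : 'I_(\rank A) -> 'I_m) (g : 'I_(\rank A) -> 'I_n),
    mxsub f g A \in unitmx.
Proof.
pose f := maxrankfun A; pose A1 := rowsub f A.
have A1full : row_full A1^T.
  by rewrite /row_full mxrank_tr; exact: maxrowsub_free.
exists f, (fullrankfun A1full).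
rewrite -unitmx_tr; have := fullrowsub_unit A1full.
by rewrite (_ : rowsub _ _ = (mxsub f (fullrankfun A1full) A)^T) //;
  apply/matrixP => i j; rewrite !mxE.
Qed.

(** * Closedness of the rank condition *)

Section RankClosed.
Variable R : realType.
Local Notation C := R[i].

Lemma rank_frac_eval m (P : 'M[{poly C}]_m) p (f g : 'I_p -> 'I_m) :
    mxsub f g (ratmx P) \in unitmx ->
  exists alpha, mxsub f g (map_mx (horner_eval alpha) P) \in unitmx.
Proof.
rewrite /ratmx -map_mxsub unitmxE det_map_mx unitfE tofrac_eq0 => d0.
pose D := \det (mxsub f g P).
(* A nonzero polynomial has fewer roots than its size, so one of these [size D] distinct numbers is
   not a root. *)
pose rs := [seq (i%:R : C) | i <- iota 0 (size D)].
have [a _ Da] : exists2 a, a \in rs & ~~ root D a.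
  apply/allPn; apply/negP => ars.
  have urs : uniq rs.
    rewrite map_inj_uniq ?iota_uniq //; exact: mulrIn (oner_neq0 _).
  by have := max_poly_roots d0 ars urs; rewrite size_map size_iota ltnn.
exists a; rewrite -map_mxsub unitmxE det_map_mx unitfE; exact: Da.
Qed.

Lemma rank_frac_ge m (P : 'M[{poly C}]_m) p (f g : 'I_p -> 'I_m) alpha :
    mxsub f g (map_mx (horner_eval alpha) P) \in unitmx ->
  (p <= mprank P)%N.
Proof.
rewrite -map_mxsub unitmxE det_map_mx unitfE => d0.
have u : mxsub f g (ratmx P) \in unitmx.
  rewrite /ratmx -map_mxsub unitmxE det_map_mx unitfE tofrac_eq0.
  by apply: contraNneq d0 => ->; rewrite rmorph0.
rewrite -(mxrank_unit u) /mprank mxsubrc rowsubE.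
rewrite -[ratmx P in X in (X <= _)%N]mulmx1 -mulmx_colsub.
by rewrite (leq_trans (mxrankM_maxr _ _)) // mxrankM_maxl.
Qed.

(** Rank is lower semicontinuous: a nonzero minor of maximal size, evaluated at a point where it
    does not vanish, stays nonzero for all nearby Q. *)
Lemma closed_mprank_le d m q :
  closed [set P : POLss R d m | (mprank P <= q)%N].
Proof.
move=> P /closure_mpdist near; rewrite /= leqNgt; apply/negP => lt.
have [f [g fg]] := full_rank_minor (ratmx P).
have [a fga] := rank_frac_eval fg.
have [e e0 eY] := unitmx_near fga.
(* Evaluation at a changes each entry by at most S times the distance. *)
pose S := \sum_(l < d.+1) `|a| ^+ l : C.
have S0 : 0 <= S by rewrite sumr_ge0 // => l _; rewrite exprn_ge0.
have S1 : 0 < S + 1 by rewrite ltr_wpDl.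
(* The distance is real while [e] lies in R[i]; a positive element there equals its real part. *)
have er : e / (S + 1) = (complex.Re (e / (S + 1)))%:C%C.
  by rewrite [RHS]RRe_real // ger0_real // ltW // divr_gt0.
have [|Q /= Qq PQ] := near (complex.Re (e / (S + 1))).
  by rewrite -ltcR -er divr_gt0.
suff : (\rank (ratmx P) <= mprank Q)%N.
  by rewrite leqNgt (leq_ltn_trans Qq lt).
apply: (@rank_frac_ge _ Q _ f g a); apply: eY => i j; rewrite !mxE.
have [sP _] := POLssP P; have [sQ _] := POLssP Q.
rewrite /horner_eval.
rewrite (horner_coef_wide _ (sP _ _)) (horner_coef_wide _ (sQ _ _)).
rewrite -sumrB (le_lt_trans (ler_norm_sum _ _ _)) //.
apply: (@le_lt_trans _ _ ((mpdist d P Q)%:C%C * S)).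
  rewrite mulr_sumr; apply: ler_sum => l _.
  rewrite -mulrBl normrM normrX ler_wpM2r ?exprn_ge0 // normr_normc lecR.
  by rewrite coef_le_mpdist // -ltnS.
apply: (@le_lt_trans _ _ (e / (S + 1) * S)).
  by rewrite ler_wpM2r // er lecR ltW.
by rewrite mulrAC ltr_pdivrMr // ltr_pM2l // ltrDl.
Qed.

End RankClosed.

(** * Density of the generic products *)

Lemma wedge_line (A : comNzRingType) q m (U V U' V' : 'M[A]_(q, m)) c :
  wedge (U + c *: U') (V + c *: V') =
  wedge U V + c *: ((wedge U V' + wedge U' V) + c *: wedge U' V').
Proof.
apply/matrixP => j k; rewrite !(wedgeE, mxE) -big_split /=.
rewrite mulr_sumr -big_split /= mulr_sumr -big_split /=; apply: eq_bigr => i _.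
by rewrite !mxE; ring.
Qed.

Lemma wedgeC (A : comNzRingType) q m (U V : 'M[A]_(q, m)) :
  wedge V (- U) = wedge U V.
Proof.
apply/matrixP => j k; rewrite !wedgeE; apply: eq_bigr => i _.
by rewrite !mxE; ring.
Qed.

Lemma small_non_root (R : realType) (D : {poly R[i]}) (delta : R) :
    D != 0 -> 0 < delta ->
  exists s : R, 0 < s < delta /\ D.[s%:C%C] != 0.
Proof.
(* Starting at delta / 2 keeps every candidate strictly below delta. *)
move=> D0 delta0; pose x i : R := delta / i.+2%:R.
pose rs := [seq (x i)%:C%C | i <- iota 0 (size D)].
have [a ars Da] : exists2 a, a \in rs & ~~ root D a.
  apply/allPn; apply/negP => ars.
  have urs : uniq rs.
    rewrite map_inj_uniq ?iota_uniq // => i j [] /(mulfI (lt0r_neq0 delta0)).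
    by move=> /invr_inj/eqP; rewrite eqr_nat => /eqP[].
  by have := max_poly_roots D0 ars urs; rewrite size_map size_iota ltnn.
have /mapP[i _ ai] := ars; exists (x i); split; last by rewrite -ai.
by rewrite /x divr_gt0 //= ltr_pdivrMr // ltr_pMr // ltr1n.
Qed.

Section Density.
Variables (R : realType) (d m r k : nat).
Local Notation C := R[i].
Hypothesis dk : d = k.*2.+1.
Variable A : set (POLss R d m).

Lemma wedge_POLss (U V : 'M[{poly C}]_(r, m)) (a b : 'I_r -> nat) :
    row_degrees_le U a -> row_degrees_le V b ->
    (forall i, (a i + b i <= d)%N) ->
  exists Q : POLss R d m, POLss_val Q = wedge U V.
Proof.
move=> Ua Vb abd; apply: POLss_ex; last exact: tr_wedge.
move=> j l; rewrite wedgeE (leq_trans (size_sum _ _ _)) //.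
apply/bigmax_leqP => i _; rewrite (leq_trans (size_polyD _ _)) // size_polyN.
rewrite geq_max (size_polyM_leq (Ua i j) (Vb i l) (abd i)) /=.
by rewrite (size_polyM_leq (Vb i j) (Ua i l)) // addnC.
Qed.

Variables (beta : nat) (U1 V1 : 'M[{poly C}]_(r, m)).
Hypotheses (sU1 : mxsize_le k.+1 U1) (sV1 : mxsize_le k.+2 V1).
Hypothesis free1 : row_free (synmx k beta U1 V1).
Hypothesis full1 : row_full (synmx k beta.+1 U1 V1).
Hypothesis A_generic : forall (U V : 'M[{poly C}]_(r, m)) (Q : POLss R d m),
  mxsize_le k.+1 U -> mxsize_le k.+2 V -> row_free (synmx k beta U V) ->
  row_full (synmx k beta.+1 U V) -> POLss_val Q = wedge U V -> A Q.

(* On the line through (U, V) and (U1, V1) all but finitely many points are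
   generic. *)
Lemma closure_wedge (U V : 'M[{poly C}]_(r, m)) (P : POLss R d m) :
    mxsize_le k.+1 U -> mxsize_le k.+2 V -> POLss_val P = wedge U V ->
  closure A P.
Proof.
move=> sU sV PE; pose U' := U1 - U; pose V' := V1 - V.
have line N (c : C) : (synmx k N U V + c *: synmx k N U' V')%R =
    synmx k N (U + c%:P *: U') (V + c%:P *: V') by rewrite synmxD.
(* The parameter value 1 is the known generic pair, which is what makes [D] and [E] below
   nonzero. *)
have at1 N : (synmx k N U V + 1 *: synmx k N U' V')%R = synmx k N U1 V1.
  by rewrite line polyC1 !scale1r !subrKC.
have [D D0 DP] : exists2 D : {poly C}, D != 0 &
    forall s, D.[s] != 0 ->
      row_free (synmx k beta U V + s *: synmx k beta U' V')%R.
  by apply: (@row_free_generic _ _ _ _ _ 1); rewrite at1.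
have [E E0 EP] : exists2 E : {poly C}, E != 0 &
    forall s, E.[s] != 0 ->
      row_full (synmx k beta.+1 U V + s *: synmx k beta.+1 U' V')%R.
  by apply: (@row_full_generic _ _ _ _ _ 1); rewrite at1.
have size_line l s (X Y : 'M[{poly C}]_(r, m)) : mxsize_le l X ->
    mxsize_le l Y -> mxsize_le l (X + s%:P *: (Y - X)).
  move=> sX sY i j; rewrite !mxE (leq_trans (size_polyD _ _)) // geq_max sX /=.
  rewrite mul_polyC (leq_trans (size_scale_leq _ _)) //.
  by rewrite (leq_trans (size_polyD _ _)) // size_polyN geq_max sX sY.
apply: (@closure_quadratic _ _ _ _ _ (wedge U V' + wedge U' V) (wedge U' V')).
move=> delta delta0.
have [|s [sd]] := @small_non_root _ (D * E) delta _ delta0.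
  by rewrite mulf_neq0.
rewrite hornerM mulf_eq0 negb_or => /andP[Ds Es]; exists s; split=> //.
have sUs := size_line _ (s%:C)%C _ _ sU sU1.
have sVs := size_line _ (s%:C)%C _ _ sV sV1.
have [|Q QE] := @wedge_POLss _ _ (fun=> k) (fun=> k.+1) sUs sVs.
  by move=> _; rewrite dk -addnn addnS.
exists Q; last by rewrite PE QE wedge_line.
by apply: (A_generic sUs sVs _ _ QE); rewrite -line; [exact: DP|exact: EP].
Qed.

(* If V has row degree e = d - b at i0, with leading coefficient x, then
   u_s = u + s X^(b+1) x and v_s = v - s^-1 X^(e-b-1) u_s have degrees b + 1
   and e - 1, and u_s ^ v_s = u_s ^ v tends to u ^ v. *)
Lemma closure_wedge_unbalanced (U V : 'M[{poly C}]_(r, m)) (b : 'I_r -> nat)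
    (P : POLss R d m) :
    (forall i, (b i <= k)%N) -> row_degrees_le U b ->
    row_degrees_le V (fun i => d - b i)%N -> POLss_val P = wedge U V ->
  closure A P.
Proof.
(* The induction counts the unit steps still missing until every b i equals k. *)
have [n] := ubnP (\sum_i (k - b i)); elim: n => // n IH in U V b P *.
rewrite ltnS => le_n bk Ub Vb PE.
have [/forallP kb|/forallPn[i0]] := boolP [forall i, k <= b i]%N.
  have bE i : b i = k by apply/eqP; rewrite eqn_leq bk kb.
  apply: (closure_wedge (U := U) (V := V)) => // i j.
    by rewrite -(bE i).
  by have := Vb i j; rewrite bE dk -addnn subSn ?leq_addr // addnK.
rewrite -ltnNge => bk0; pose b0 := b i0; pose e := (d - b0)%N.
pose b' i := if i == i0 then b0.+1 else b i.
pose x := \row_j (V i0 j)`_e.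
pose Y : 'M[{poly C}]_(r, m) :=
  \matrix_(i, j) if i == i0 then 'X^(b0.+1) * (x 0 j)%:P else 0.
(* By induction the approximants lie in [closure A], so the limit is taken in that closed set. *)
apply: (@closed_closure _ A).
apply: (@closure_quadratic _ _ _ _ _ (wedge Y V) 0).
move=> delta delta0; pose s := delta / 2; have s0 : 0 < s by rewrite divr_gt0.
exists s; split; first by rewrite s0 ltr_pdivrMr // ltr_pMr // ltr1n.
pose sC := (s%:C)%C; have sC0 : sC != 0.
  by apply: contraTneq s0 => -[->]; rewrite ltxx.
pose Us := U + sC%:P *: Y.
pose c i : {poly C} := if i == i0 then (sC^-1)%:P * 'X^(e - b0.+1) else 0.
pose Vs := \matrix_(i, j) (V i j - c i * Us i j).
have UsE i j : Us i j = U i j + sC%:P * Y i j.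
  by rewrite [LHS]mxE [X in _ + X]mxE.
have VsE i j : Vs i j = V i j - c i * Us i j by rewrite [LHS]mxE.
(* Subtracting from a row of [V] a multiple of the same row of [Us] leaves the product unchanged, so
   the perturbation is linear in [sC]. *)
have WE : wedge Us Vs = wedge U V + sC%:P *: (wedge Y V + sC%:P *: 0).
  rewrite scaler0 addr0; apply/matrixP => j l.
  rewrite wedgeE [RHS]mxE [X in _ + X]mxE !wedgeE mulr_sumr -big_split.
  by apply: eq_bigr => i _; rewrite !VsE !UsE /=; ring.
have sY i j : (size (Y i j) <= (b' i).+1)%N.
  rewrite mxE /b'; case: eqP => _; last by rewrite size_poly0.
  by rewrite mulrC mul_polyC (leq_trans (size_scale_leq _ _)) // size_polyXn.
have Usb : row_degrees_le Us b'.
  move=> i j; rewrite UsE (leq_trans (size_polyD _ _)) // geq_max.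
  apply/andP; split; last first.
    rewrite mul_polyC (leq_trans (size_scale_leq _ _)) //; exact: sY.
  by rewrite (leq_trans (Ub i j)) // /b'; case: eqP => [->|].
have sc (a : nat) : (size ((sC^-1)%:P * 'X^a)%R <= a.+1)%N.
  by rewrite mul_polyC (leq_trans (size_scale_leq _ _)) // size_polyXn.
have eb : (b0.+1 <= e)%N by rewrite /e dk -addnn /b0; lia.
have Vsb : row_degrees_le Vs (fun i => d - b' i)%N.
  move=> i j; rewrite VsE /c /b' /=; case: eqP => [->|_]; last first.
    by rewrite mul0r subr0.
  rewrite [(d - b0.+1)%N]subnS -/e prednK; last by apply: leq_trans eb.
  apply: size_leq_coef0.
    rewrite (leq_trans (size_polyD _ _)) // size_polyN geq_max Vb /=.
    apply: size_polyM_leq (sc _) (Usb _ _) _.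
    by rewrite /b' eqxx subnK.
  have sUs : (size (Us i0 j) <= b0.+2)%N by have := Usb i0 j; rewrite /b' eqxx.
  have := coef_mul_top (sc (e - b0.+1)%N) sUs; rewrite subnK // => top.
  rewrite coefB top coefCM coefXn eqxx mulr1 UsE coefD.
  rewrite [(U i0 j)`__]nth_default; last exact: Ub.
  rewrite add0r [Y i0 j]mxE eqxx coefCM coefMC coefXn eqxx mul1r mulrA mulVf //.
  by rewrite mul1r mxE subrr.
have [i|Q QE] := wedge_POLss Usb Vsb.
  by rewrite subnKC // /b'; case: ifP => _; have := bk i; rewrite /b0 dk; lia.
exists Q; last by rewrite QE WE PE.
apply: (IH _ _ b' _ _ _ Usb Vsb QE).
  apply: leq_trans le_n; rewrite (bigD1 i0) //= [X in (_ <= X)%N](bigD1 i0) //=.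
  rewrite -addSn leq_add //; first by rewrite /b' eqxx -/b0; lia.
  by apply: leq_sum => i /negPf ii0; rewrite /b' ii0.
by move=> i; rewrite /b'; case: eqP.
Qed.

Lemma closure_rank_le (P : POLss R d m) : (mprank P <= 2 * r)%N -> closure A P.
Proof.
move=> rP; have [sP skP] := POLssP P.
have [U [V PE]] := skew_wedge skP rP.
pose deg (X : 'M[{poly C}]_(r, m)) i := \max_j size (X i j).
have dle X : row_degrees_le X (deg X).
  move=> i j; rewrite ltnW // ltnS.
  exact: (leq_bigmax (F := fun j => size (X i j))).
rewrite PE in sP.
have [U2 [V2 [a [b [W2 U2a V2b abd]]]]] :=
  wedge_degree_reduction (dle U) (dle V) sP.
have [U3 [V3 [a' [b' [W3 U3a V3b ab' ba]]]]] := wedge_swap U2a V2b.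
(* The factor of low degree must come first, hence the exchange u ^ v = v ^ (-u); b' i <= a' i and
   a' i + b' i <= 2 k + 1 give b' i <= k. *)
apply: (@closure_wedge_unbalanced V3 (- U3) b' P) => //.
- move=> i; have := abd i; have := ba i; have := ab' i.
  by rewrite dk -addnn; lia.
- move=> i j; rewrite mxE size_polyN (leq_trans (U3a i j)) // ltnS.
  by have := abd i; have := ab' i; lia.
- by rewrite wedgeC W3 W2.
Qed.

End Density.

(** * The generic orbit *)

Section GenericOrbit.
Variables (R : realType) (m r n k t beta : nat).
Local Notation C := R[i].
Hypotheses (mE : m = (2 * r + n)%N) (rdE : (r * k.*2.+1 = n * beta + t)%N).
Hypothesis tn : (t <= n)%N.

Definition generic_factors (U V : 'M[{poly C}]_(r, m)) :=
  [/\ mxsize_le k.+1 U, mxsize_le k.+2 V, row_free (synmx k beta U V) &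
      row_full (synmx k beta.+1 U V)].

Variables U V : 'M[{poly C}]_(r, m).
Hypothesis gUV : generic_factors U V.
Local Notation P := (wedge U V).

Lemma generic_elementary_divisors alpha e :
  elementary_divisors P alpha e <-> e = [::].
Proof.
case: gUV => sU sV _ full; have [Y MY] := synmx_full_right_inv sU sV full.
have [rm [A [B [Au Bu APB]]]] := wedge_pid MY.
exact: elementary_divisors_nil rm Au Bu APB _ _.
Qed.

Lemma generic_rev_pid : exists A B, [/\ A \in unitmx, B \in unitmx,
  A *m mprev k.*2.+1 P *m B = pid_mx (r + r) & (r + r <= m)%N].
Proof.
case: gUV => sU sV _ full.
have sU' : mxsize_le k.+1 (map_mx (revp k) U).
  by move=> i j; rewrite mxE size_revp.
have sV' : mxsize_le k.+2 (map_mx (revp k.+1) V).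
  by move=> i j; rewrite mxE size_revp.
have [Y MY] := synmx_full_right_inv sU' sV' (synmx_full_rev sU sV full).
have [rm [A [B [Au Bu APB]]]] := wedge_pid MY.
by exists A, B; split=> //; rewrite -[mprev _ _]/(map_mx (revp _) _) wedge_rev.
Qed.

Lemma generic_infinite_elementary_divisors e :
  infinite_elementary_divisors k.*2.+1 P e <-> e = [::].
Proof.
have [A [B [Au Bu APB rm]]] := generic_rev_pid.
exact: elementary_divisors_nil rm Au Bu APB _ _.
Qed.

(** The leading coefficient is the value at 0 of the reversal, where the rank is still 2 r > 0. *)
Lemma generic_lead_neq0 : (0 < r)%N -> mpcoef k.*2.+1 P != 0.
Proof.
move=> r0; have [A [B [Au Bu APB rm]]] := generic_rev_pid.
have := rank_map_pid rm Au Bu APB (horner_eval (0 : C)).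
apply: contra_eqN => /eqP P0.
suff -> : map_mx (horner_eval 0) (mprev k.*2.+1 P) = 0.
  by rewrite mxrank0 eq_sym -lt0n addn_gt0 r0.
apply/matrixP => i j; rewrite !mxE /horner_eval horner_coef0 coef_poly subn0.
by move/matrixP: P0 => /(_ i j); rewrite !mxE.
Qed.

Lemma generic_left_minimal_indices e : left_minimal_indices P e <->
  perm_eq e (nseq t beta.+1 ++ nseq (n - t) beta).
Proof.
case: gUV => sU sV free full; apply: minimal_indices_null => //.
exact/eqmxP.
Qed.

Lemma generic_right_minimal_indices e : right_minimal_indices P e <->
  perm_eq e (nseq t beta.+1 ++ nseq (n - t) beta).
Proof.
case: gUV => sU sV free full; apply: minimal_indices_null => //.
have -> : (ratmx P)^T = - ratmx P.
  by rewrite /ratmx map_trmx tr_wedge map_mxN.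
apply/andP; split; apply/rV_subP => v /sub_kermxP vP; apply/sub_kermxP.
  by apply/eqP; rewrite -oppr_eq0 -mulmxN vP.
by rewrite mulmxN vP oppr0.
Qed.

End GenericOrbit.

Theorem theorem5p2 (R : realType) (m r d : nat)
    (m_ge2 : (2 <= m)%N) (d_ge1 : (1 <= d)%N) (d_odd : odd d)
    (r_bounds : (2 <= 2 * r <= m - 1)%N) :
  let beta := ((r * d) %/ (m - 2 * r))%N in
  let t := ((r * d) %% (m - 2 * r))%N in
  let min_ind := nseq t beta.+1 ++ nseq (m - 2 * r - t) beta in
  exists W : POLss R d m,
    [/\ mpcoef d W != 0 /\ mprank W = (2 * r)%N,
        (forall alpha : R[i], elementary_divisors W alpha [::]) /\
          infinite_elementary_divisors d W [::],
        left_minimal_indices W min_ind /\ right_minimal_indices W min_ind,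
        closed [set P : POLss R d m | (mprank P <= 2 * r)%N] &
        [set P : POLss R d m | (mprank P <= 2 * r)%N]
          = closure (POLss_orbit W)].
Proof.
move=> beta t min_ind; pose k := d./2; pose n := (m - 2 * r)%N.
have dk : d = k.*2.+1 by rewrite -[LHS]odd_double_half d_odd.
have [r0 rm] : (0 < r)%N /\ (2 * r < m)%N by lia.
have n0 : (0 < n)%N by rewrite subn_gt0.
have mE : m = (2 * r + n)%N by rewrite subnKC // ltnW.
have rdE : (r * k.*2.+1 = n * beta + t)%N.
  by rewrite -dk [LHS](divn_eq _ n) [(_ * n)%N]mulnC.
have tn : (t <= n)%N by rewrite ltnW // ltn_mod.
have [U [V [sU sV free full]]] := synmx_generic_ex R[i] k r0 rm.
rewrite -dk -/beta in free full.
have gUV : generic_factors k beta U V by split.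
have [|W WE] := @wedge_POLss R d m r U V (fun=> k) (fun=> k.+1) sU sV.
  by move=> _; rewrite dk -addnn addnS.
(* All generic products share one eigenstructure, since each of its four components is characterized
   independently of the factors. *)
have orbit_generic (U' V' : 'M[{poly R[i]}]_(r, m)) (Q : POLss R d m) :
    generic_factors k beta U' V' ->
    POLss_val Q = wedge U' V' -> POLss_orbit W Q.
  move=> g' QE; rewrite /POLss_orbit /= /same_complete_eigenstructure WE QE.
  split=> [alpha e|e|e|e].
  - exact: iff_trans (generic_elementary_divisors gUV alpha e)
      (iff_sym (generic_elementary_divisors g' alpha e)).
  - rewrite dk; exact: iff_trans (generic_infinite_elementary_divisors gUV e)
      (iff_sym (generic_infinite_elementary_divisors g' e)).
  - exact: iff_trans (generic_left_minimal_indices mE rdE tn gUV e)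
      (iff_sym (generic_left_minimal_indices mE rdE tn g' e)).
  - exact: iff_trans (generic_right_minimal_indices mE rdE tn gUV e)
      (iff_sym (generic_right_minimal_indices mE rdE tn g' e)).
have left_W : left_minimal_indices W min_ind.
  rewrite WE; apply: (generic_left_minimal_indices mE rdE tn gUV _).2.
  exact: perm_refl.
have right_W : right_minimal_indices W min_ind.
  rewrite WE; apply: (generic_right_minimal_indices mE rdE tn gUV _).2.
  exact: perm_refl.
(* The number of left minimal indices is the dimension m - rank Q of the left null space; it is n on
   the orbit, so the rank is 2 r there. *)
have orbit_rank (Q : POLss R d m) : POLss_orbit W Q -> (mprank Q <= 2 * r)%N.
  move=> [_ _ leftWQ _]; have := (leftWQ min_ind).1 left_W.
  case=> p [B [[/andP[Bfree /eqmxP BQ] _] /perm_size]].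
  rewrite size_cat !size_nseq subnKC // size_map size_enum_ord => pn.
  have := eqP Bfree; rewrite BQ mxrank_ker -pn -/(mprank Q) /n.
  have := rank_leq_row (ratmx Q); rewrite -/(mprank Q); lia.
have cl := @closed_mprank_le R d m (2 * r).
exists W; split=> //.
- rewrite WE {1}dk; split; first exact: (generic_lead_neq0 gUV r0).
  exact: rank_ratmx_wedge sU sV full.
- rewrite WE {1}dk; split=> [alpha|].
    exact/(generic_elementary_divisors gUV).
  exact/(generic_infinite_elementary_divisors gUV).
apply/seteqP; split=> [P rP|].
  apply: (closure_rank_le dk sU sV free full _ rP) => U' V' Q sU' sV' fr' fu'.
  by apply: orbit_generic; split.
(* The orbit lies in a closed set, hence so does its closure. *)
by move=> P; move/closure_id: cl => ->; apply: closure_subset.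
Qed.
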